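(* Let $m,n,d,e,k$ be positive integers with $m=2n$, $e=\gcd(n,d)=\gcd(m,d)$ and $1\le k\le \frac{n}{e}$, and let $C$ be the binary code described in the context. Then \[\#\{c\in C\mid {\rm DC}(c)=-1\}=2^{n(2k+1)}-1-\sum_{v=0}^{k-1}(-1)^v\big(2^{n(2k-1-2v)+ev}-1\big)2^{m-ev(v+1)}\prod_{j=0}^{v-1}(2^m-4^{ej}).\]
   Context: For $\vec a=(a_0,a_1,\dots,a_k)\in\mathbb{F}_{2^n}\times\mathbb{F}_{2^m}^k$ define $Q_{\vec a}:\mathbb{F}_{2^m}\to\mathbb{F}_{2^e}$ by \[Q_{\vec a}(x)={\rm Tr}_{\mathbb{F}_{2^n}/\mathbb{F}_{2^e}}\big(a_0x^{2^{nd/e}+1}\big)+\sum_{j=1}^{k-1}{\rm Tr}_{\mathbb{F}_{2^m}/\mathbb{F}_{2^e}}\big(a_jx^{2^{(\frac{n}{e}-j)d}+1}\big)+{\rm Tr}_{\mathbb{F}_{2^m}/\mathbb{F}_{2^e}}(a_kx).\] Here $x^{2^{nd/e}+1}\in\mathbb{F}_{2^n}$. Let $\pi$ be a primitive element of $\mathbb{F}_{2^m}$. Let $c_{\vec a}=(c_{\vec a,0},\dots,c_{\vec a,2^m-2})$ with $c_{\vec a,i}={\rm Tr}_{\mathbb{F}_{2^e}/\mathbb{F}_2}(Q_{\vec a}(\pi^{-i}))$, and let $C=\{c_{\vec a}\mid\vec a\in\mathbb{F}_{2^n}\times\mathbb{F}_{2^m}^k\}$. For $c=(c_0,\dots,c_{2^m-2})\in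 C$, ${\rm DC}(c)=\sum_{i=0}^{2^m-2}(-1)^{c_i}$. *)

(* Defs.v *)
From mathcomp Require Import all_boot all_order all_algebra all_field.
Set Implicit Arguments. Unset Strict Implicit. Unset Printing Implicit Defensive.
Import GRing.Theory Num.Theory.
Local Open Scope ring_scope.

(* Trace from F_{2^(q*r)} down to F_{2^q}, computed inside an ambient field F
   of characteristic 2 containing F_{2^(q*r)}:  Tr(y) = sum_{i<r} y^(2^(q i)). *)
Definition tr2 (F : finFieldType) (q r : nat) (y : F) : F :=
  \sum_(i < r) y ^+ (2 ^ (q * i)).

(* Coefficient vectors a = (a_0, ..., a_k) with a_0 in F_{2^n} (the subfield of
   F = F_{2^m} fixed by x |-> x^(2^n)) and a_1..a_k in F. *)
Definition coeff_dom (F : finFieldType) (n k : nat) : {set {ffun 'I_k.+1 -> F}} :=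
  [set a : {ffun 'I_k.+1 -> F} | a ord0 ^+ (2 ^ n) == a ord0].

Definition Qa (F : finFieldType) (m n d e k : nat) (a : {ffun 'I_k.+1 -> F}) (x : F) : F :=
  tr2 e (n %/ e) (a ord0 * x ^+ (2 ^ (n * d %/ e) + 1))
  + \sum_(1 <= j < k) tr2 e (m %/ e) (a (inord j) * x ^+ (2 ^ ((n %/ e - j) * d) + 1))
  + tr2 e (m %/ e) (a ord_max * x).

(* The codeword c_a, as a binary word of length 2^m - 1:
   c_{a,i} = Tr_{F_{2^e}/F_2}(Q_a(pi^{-i})), an element of F_2 = {0,1},
   encoded as the boolean (value != 0). *)
Definition codeword (F : finFieldType) (m n d e k : nat) (pi : F)
  (a : {ffun 'I_k.+1 -> F}) : {ffun 'I_(2 ^ m).-1 -> bool} :=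
  [ffun i : 'I_(2 ^ m).-1 => tr2 1 e (Qa m n d e a (pi^-1 ^+ i)) != 0].

Definition code (F : finFieldType) (m n d e k : nat) (pi : F)
  : {set {ffun 'I_(2 ^ m).-1 -> bool}} :=
  [set codeword m n d e pi a | a in coeff_dom F n k].

Definition DC (N : nat) (c : {ffun 'I_N -> bool}) : int :=
  \sum_(i < N) (-1) ^+ (c i : nat).

(* Main.v *)
(** Let [q = 2 ^ e], [N = n / e] and [s x = x ^ (2 ^ d)], an automorphism of order [2 N]
    with fixed field [K] of [q] elements.  Polarizing [Q_a] gives the alternating form
    [(x, y) |-> tr (y * L_a x)], where [L_a] only involves [s ^ i] for
    [N - k < i < N + k].  If [L_a <> 0] its kernel has size [q ^ (2 i)] with [i < k]:
    a nonzero [s]-polynomial of degree [r] has at most [q ^ r] zeros, and the rank of an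
    alternating form is even.  The exponential sum [S_a] of [Q_a] satisfies
    [S_a ^ 2 = 0] or [|F| |ker L_a|], and averaging [S_a ^ 2] over the linear coefficient
    [a_k] shows that the number of [a] with [S_a <> 0] is the sum of [1 / |ker L_a|].

    Since nonzero kernels take only [k] sizes, this sum is determined by the
    moments of [|ker L_a|] of degree less than [k].  For [K]-independent [u_1 .. u_t],
    character orthogonality expresses the number of [a] with all [L_a u_i = 0] through the
    number of [w_1 .. w_t] such that [sum_i u_i /\ w_i] is orthogonal to every [a].
    Such a bivector vanishes for [t < k]: the associated operator of rank at most
    [2 t] is a power of [s] times an [s]-polynomial of degree at most [2 (N - k)].  This makes
    the moments in the basis [prod_(j < t) (R - q ^ j)] explicit; a change of basis to
    [prod_(j < v) (R - q ^ (2 j))] yields the closed formula. *)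

Require Import Defs.
From mathcomp Require Import all_boot all_order all_algebra all_field.
From mathcomp Require Import zify ring.
From HB Require Import structures.
Import GRing.Theory Num.Theory.
Local Open Scope ring_scope.
Set Implicit Arguments. Unset Strict Implicit. Unset Printing Implicit Defensive.

(** * Additive subsets of finite abelian groups *)

Definition addset (V : finZmodType) (S : {set V}) : Prop :=
  0 \in S /\ {in S &, forall x y, x - y \in S}.

Lemma addsetN (V : finZmodType) (S : {set V}) x :
  addset S -> x \in S -> - x \in S.
Proof. by case=> S0 SB Sx; rewrite -sub0r SB. Qed.

Lemma addsetD (V : finZmodType) (S : {set V}) x y :
  addset S -> x \in S -> y \in S -> x + y \in S.
Proof. by move=> hS Sx Sy; rewrite -[y]opprK hS.2 ?addsetN. Qed.

Lemma addsetDr (V : finZmodType) (S : {set V}) x y :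
  addset S -> y \in S -> (x + y \in S) = (x \in S).
Proof.
move=> hS Sy; apply/idP/idP=> [Sxy|Sx]; last exact: addsetD.
by rewrite -(addrK y x) hS.2.
Qed.

(** The fibre of [g] through [x0] is the translate by [x0] of the fibre over zero. *)
Lemma card_addset_fibers (V W : finZmodType) (S : {set V}) (g : V -> W) :
  addset S -> {morph g : x y / x - y} ->
  #|S| = (#|g @: S| * #|[set x in S | g x == 0%R]|)%N.
Proof.
move=> hS gB; rewrite -sum1_card (partition_big_imset g) /=.
rewrite -sum_nat_const; apply: eq_bigr => _ /imsetP[x0 Sx0 ->].
rewrite (reindex_inj (addIr x0)) /= -sum1_card.
apply: eq_bigl => x; rewrite inE addsetDr //; congr andb.
have g0 : g 0 = 0 by rewrite -(subrr 0) gB subrr.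
have gN y : g (- y) = - g y by rewrite -sub0r gB g0 sub0r.
by rewrite -[x0]opprK gB !gN opprK -subr_eq0 addrK.
Qed.

(** * Zeros of skew polynomials *)

Section SkewPolynomials.

Variables (F : finFieldType) (s : {rmorphism F -> F}).

Definition fixfield : {set F} := [set x | s x == x].

Definition siter l (x : F) := iter l s x.

Fact siter_is_zmod_morphism l : zmod_morphism (siter l).
Proof. by elim: l => // l IH x y; rewrite /siter /= -/(siter l _) IH rmorphB. Qed.

Fact siter_is_monoid_morphism l : monoid_morphism (siter l).
Proof.
elim: l => [|l [IH1 IH2]]; first by [].
split; first by rewrite /siter /= -/(siter l _) IH1 rmorph1.
by move=> x y; rewrite /siter /= -!/(siter l _) IH2 rmorphM.
Qed.

HB.instance Definition _ l :=
  GRing.isZmodMorphism.Build F F (siter l) (siter_is_zmod_morphism l).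
HB.instance Definition _ l :=
  GRing.isMonoidMorphism.Build F F (siter l) (siter_is_monoid_morphism l).

Lemma siterD k l x : siter (k + l) x = siter k (siter l x).
Proof. exact: iterD. Qed.

Lemma siterS l x : siter l.+1 x = s (siter l x).
Proof. by []. Qed.

Lemma siterSr l x : siter l.+1 x = siter l (s x).
Proof. exact: iterSr. Qed.

Lemma siter_fix l c : c \in fixfield -> siter l c = c.
Proof.
rewrite inE => /eqP sc; elim: l => // l IH.
by rewrite siterS IH.
Qed.

Definition spoly (c : nat -> F) r (x : F) := \sum_(l < r) c l * siter l x.

Fact spoly_is_zmod_morphism c r : zmod_morphism (spoly c r).
Proof.
move=> x y; rewrite /spoly -sumrB; apply: eq_bigr => i _.
by rewrite rmorphB mulrBr.
Qed.

HB.instance Definition _ c r :=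
  GRing.isZmodMorphism.Build F F (spoly c r) (spoly_is_zmod_morphism c r).

(* Writing [x = z y] for a nonzero root [z], the coefficients of the rescaled
   operator sum to zero, so by Abel summation it factors through [y |-> s y - y]
   and its degree drops by one. *)
Lemma card_ker_spoly (c : nat -> F) r :
  (exists2 l, (l <= r)%N & c l != 0) ->
  (#|[set x | spoly c r.+1 x == 0%R]| <= #|fixfield| ^ r)%N.
Proof.
elim: r c => [|r IH] c [l lr cl].
  rewrite leqn0 in lr; rewrite (eqP lr) in cl.
  rewrite expn0 (_ : [set _ | _] = [set 0]) ?cards1 //.
  apply/setP=> x; rewrite !inE /spoly big_ord1 mulf_eq0 (negPf cl).
  by [].
have [/exists_inP[z /eqP Pz z0]|noz] :=
    boolP [exists (z | spoly c r.+2 z == 0), z != 0]; last first.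
  rewrite (_ : [set _ | _] = [set 0]) ?cards1 ?expn_gt0.
    by rewrite card_gt0; apply/orP; left; apply/set0Pn; exists 0; rewrite inE rmorph0.
  apply/setP=> x; rewrite !inE; apply/idP/idP=> [Px|/eqP->]; last by rewrite raddf0.
  by apply: contraR noz => x0; apply/exists_inP; exists x.
pose b i := c i * siter i z.
pose B i := \sum_(i.+1 <= j < r.+2) b j.
have sz i : siter i z != 0 by rewrite fmorph_eq0.
have sumb : \sum_(0 <= j < r.+2) b j = 0 by rewrite big_mkord -[RHS]Pz.
have b0B : b 0%N = - B 0%N.
  by move: sumb; rewrite big_ltn // => /eqP; rewrite addr_eq0 => /eqP.
have bB i : (i <= r)%N -> b i.+1 = B i - B i.+1.
  by move=> ir; rewrite /B [in X in X - _]big_ltn // addrK.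
have Br : B r.+1 = 0 by rewrite /B big_geq.
(* If all the tail sums [B] vanished, so would all the [b], against [c l != 0]. *)
have [l' l'r Bl'] : exists2 l', (l' <= r)%N & B l' != 0.
  have [/existsP[i Bi]|/existsPn nB] := boolP [exists i : 'I_r.+1, B i != 0].
    by exists i => //; rewrite -ltnS.
  have B0 i : (i <= r.+1)%N -> B i = 0.
    rewrite leq_eqVlt => /predU1P[->//|ir].
    by have := nB (Ordinal ir); rewrite negbK => /eqP.
  have /negP[] : b l != 0 by rewrite mulf_neq0.
  by case: l lr {cl} => [|l] lr; rewrite ?b0B ?bB // !B0 ?subrr ?oppr0 // ltnW.
pose g y := s y - y.
have gB : {morph g : x y / x - y} by move=> x y; rewrite /g rmorphB; ring.
have PB y : spoly c r.+2 (z * y) = spoly B r.+1 (g y).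
  transitivity (\sum_(0 <= l < r.+2) b l * siter l y).
    by rewrite big_mkord; apply: eq_bigr => i _; rewrite rmorphM mulrA.
  rewrite big_nat_recl // b0B.
  rewrite (eq_big_nat _ _ (F2 := fun l => B l * siter l.+1 y - B l.+1 * siter l.+1 y));
    last by move=> i /andP[_ ir]; rewrite bB // mulrBl.
  rewrite sumrB (big_nat_recr _ _ (fun l => B l.+1 * _)) //= Br mul0r addr0.
  rewrite /spoly -(big_mkord xpredT (fun l => B l * siter l (g y))).
  rewrite [RHS](eq_bigr (fun l => B l * siter l.+1 y - B l * siter l y)); last first.
    by move=> i _; rewrite /g rmorphB mulrBr siterSr.
  rewrite sumrB [X in _ = _ - X]big_nat_recl //=.
  ring.
have hK : addset [set y | spoly B r.+1 (g y) == 0].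
  split=> [|x y]; rewrite !inE ?gB; first by rewrite /g rmorph0 subr0 raddf0.
  by move=> /eqP hx /eqP hy; rewrite raddfB /= hx hy subrr.
have -> : #|[set x | spoly c r.+2 x == 0]| = #|[set y | spoly B r.+1 (g y) == 0]|.
  rewrite -!sum1_card (reindex_inj (mulfI z0)) /=.
  by apply: eq_bigl => y; rewrite !inE PB.
rewrite (card_addset_fibers hK gB) expnSr leq_mul //.
  apply: leq_trans (IH B _); last by exists l'.
  apply: subset_leq_card; apply/subsetP=> _ /imsetP[y + ->].
  by rewrite !inE.
apply: subset_leq_card; apply/subsetP=> y; rewrite !inE => /andP[_].
by rewrite subr_eq0.
Qed.

End SkewPolynomials.

(** * Linear algebra over the fixed field *)

Section FixedSpaces.

Variables (F : finFieldType) (s : {rmorphism F -> F}) (M : nat).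
Hypothesis M_gt0 : (0 < M)%N.
Hypothesis siterM : forall x : F, siter s M x = x.
Hypothesis cardF : #|F| = (#|fixfield s| ^ M)%N.
Hypothesis char2 : forall x : F, x + x = 0.

Local Notation K := (fixfield s).
Local Notation q := (#|fixfield s|).

Lemma fixfield0 : 0 \in K. Proof. by rewrite inE rmorph0. Qed.
Lemma fixfieldB x y : x \in K -> y \in K -> x - y \in K.
Proof. by rewrite !inE rmorphB => /eqP-> /eqP->. Qed.
Lemma fixfieldM x y : x \in K -> y \in K -> x * y \in K.
Proof. by rewrite !inE rmorphM => /eqP-> /eqP->. Qed.
Lemma fixfieldV x : x \in K -> x^-1 \in K.
Proof. by rewrite !inE fmorphV => /eqP->. Qed.

Lemma card_fixfield_gt1 : (1 < q)%N.
Proof.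
by rewrite (cardsD1 0) fixfield0 (cardsD1 1) !inE oner_eq0 rmorph1 eqxx.
Qed.

Definition trK (x : F) := \sum_(l < M) siter s l x.

Fact trK_is_zmod_morphism : zmod_morphism trK.
Proof. by move=> x y; rewrite -sumrB; apply: eq_bigr => i _; rewrite rmorphB. Qed.
HB.instance Definition _ := GRing.isZmodMorphism.Build F F trK trK_is_zmod_morphism.

Lemma trK_fix x : trK x \in K.
Proof.
rewrite inE /trK rmorph_sum; apply/eqP; case: M M_gt0 siterM => // M' _ sM.
rewrite big_ord_recr [RHS]big_ord_recl /= addrC; congr (_ + _).
by rewrite -siterS sM.
Qed.

Lemma trK_s x : trK (s x) = trK x.
Proof.
have /[!inE]/eqP <- := trK_fix x.
by rewrite /trK rmorph_sum; apply: eq_bigr => i _; rewrite -siterSr.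
Qed.

Lemma trKZ c x : c \in K -> trK (c * x) = c * trK x.
Proof.
move=> Kc; rewrite mulr_sumr; apply: eq_bigr => i _.
by rewrite rmorphM /= (siter_fix _ Kc).
Qed.

(** The trace is a skew polynomial of degree [M.-1] with all coefficients one, so it cannot vanish
    on the [q ^ M] multiples of a nonzero [v]. *)
Lemma trK_nondeg v : (forall x, trK (v * x) = 0) -> v = 0.
Proof.
move=> hv; have [//|v0] := eqVneq v 0; exfalso.
have := @card_ker_spoly F s (fun=> 1) M.-1; rewrite prednK // => hk.
have /hk : exists2 l, (l <= M.-1)%N & (1 : F) != 0 by exists 0%N; rewrite ?oner_eq0.
rewrite (_ : [set _ | _] = setT); last first.
  apply/setP=> x; rewrite !inE /spoly; apply/eqP.
  rewrite -[RHS](hv (v^-1 * x)) mulVKf //; apply: eq_bigr => i _.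
  by rewrite mul1r.
by rewrite cardsT cardF leq_exp2l ?card_fixfield_gt1 // leqNgt prednK // leqnn.
Qed.

Definition subspace (S : {set F}) : Prop :=
  addset S /\ forall c x, c \in K -> x \in S -> c * x \in S.

Fixpoint span (us : seq F) : {set F} :=
  if us is u :: us' then [set p.1 * u + p.2 | p in setX K (span us')] else [set 0].

Lemma span_consP u us x :
  reflect (exists2 c, c \in K & x - c * u \in span us) (x \in span (u :: us)).
Proof.
apply: (iffP imsetP) => [[[c y]] | [c Kc hx]].
  by rewrite in_setX => /andP[/= Kc hy] ->; exists c; rewrite // addrC addKr.
by exists (c, x - c * u); rewrite ?in_setX /= ?Kc ?hx // addrCA subrr addr0.
Qed.

Lemma span_subspace us : subspace (span us).
Proof.
elim: us => [|u us [[h0 hB] hZ]].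
  split; first by split=> [|x y]; rewrite !inE // => /eqP-> /eqP->; rewrite subrr.
  by move=> c x _; rewrite !inE => /eqP->; rewrite mulr0.
split; first split.
- by apply/span_consP; exists 0; rewrite ?fixfield0 // mul0r subr0.
- move=> x y /span_consP[c Kc hx] /span_consP[d Kd hy].
  apply/span_consP; exists (c - d); first exact: fixfieldB.
  by rewrite (_ : x - y - _ = (x - c * u) - (y - d * u)); [exact: hB | ring].
- move=> c x Kc /span_consP[d Kd hx]; apply/span_consP.
  exists (c * d); first exact: fixfieldM.
  by rewrite -mulrA -mulrBr hZ.
Qed.

Lemma span_min S us : subspace S -> {subset us <= S} -> {subset span us <= S}.
Proof.
case=> hS hZ; elim: us => [|u us IH] hus x.
  by rewrite inE => /eqP->; case: hS.
case/span_consP=> c Kc hx; rewrite -(subrK (c * u) x) addsetD //.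
  by apply: IH hx => y hy; apply: hus; rewrite inE hy orbT.
by rewrite hZ // hus // mem_head.
Qed.

Lemma card_span_cons u us : u \notin span us -> #|span (u :: us)| = (q * #|span us|)%N.
Proof.
move=> hu; rewrite card_in_imset ?cardsX // => -[c x] [d y].
rewrite !in_setX /= => /andP[Kc hx] /andP[Kd hy] e.
have [[h0 hB] hZ] := span_subspace us.
have [cd|cd] := eqVneq c d; first by move: e; rewrite cd => /addrI->.
case/negP: hu; have cd0 : c - d != 0 by rewrite subr_eq0.
rewrite -(mulKf cd0 u) hZ ?fixfieldV ?fixfieldB //.
rewrite (_ : _ * u = y - x); first exact: hB.
by apply: (addIr x); rewrite subrK mulrBl addrAC e addrC addKr.
Qed.

Fixpoint indep (us : seq F) : bool :=
  if us is u :: us' then (u \notin span us') && indep us' else true.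

Lemma card_span us : indep us -> #|span us| = (q ^ size us)%N.
Proof.
elim: us => [|u us IH] /=; first by rewrite cards1.
by case/andP=> hu /IH e; rewrite [LHS]card_span_cons // e expnS.
Qed.

Definition trperp (us : seq F) : {set F} :=
  [set x | all (fun u => trK (u * x) == 0) us].

Lemma trperp_cons u us x : (x \in trperp (u :: us)) = (trK (u * x) == 0) && (x \in trperp us).
Proof. by rewrite !inE. Qed.

Lemma trperp_addset us : addset (trperp us).
Proof.
split=> [|x y]; rewrite !inE.
  by apply/allP=> u _; rewrite mulr0 raddf0.
move=> /allP hx /allP hy; apply/allP=> u hu.
by rewrite mulrBr raddfB /= (eqP (hx u hu)) (eqP (hy u hu)) subrr.
Qed.

Lemma trperpZ us c x : c \in K -> x \in trperp us -> c * x \in trperp us.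
Proof.
move=> Kc; rewrite !inE => /allP hx; apply/allP=> u hu.
by rewrite mulrCA (trKZ _ Kc) (eqP (hx u hu)) mulr0.
Qed.

(** Double orthogonality, by induction on the list: a multiple of [u] is subtracted from [v] so that
    the difference kills all of [trperp us]. *)
Lemma trperp_span us v : {in trperp us, forall x, trK (v * x) = 0} -> v \in span us.
Proof.
elim: us v => [|u us IH] v hv.
  by rewrite inE; apply/eqP/trK_nondeg => x; apply: hv; rewrite inE.
have [/exists_inP[x1 ox1 vx1]|/exists_inPn h] :=
  boolP [exists (x | x \in trperp us), trK (v * x) != 0]; last first.
  apply/span_consP; exists 0; rewrite ?fixfield0 // mul0r subr0.
  by apply: IH => x /h; rewrite negbK => /eqP.
have ux1 : trK (u * x1) != 0.
  by apply: contra vx1 => ux1; rewrite hv // trperp_cons ux1.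
apply/span_consP; exists (trK (v * x1) / trK (u * x1)).
  by rewrite fixfieldM ?fixfieldV ?trK_fix.
apply: IH => x ox; set c := _ / _.
(* Correcting [x] along [x1] makes it orthogonal to [u] as well. *)
pose y := x - trK (u * x) / trK (u * x1) * x1.
have Kd : trK (u * x) / trK (u * x1) \in K by rewrite fixfieldM ?fixfieldV ?trK_fix.
have /hv : y \in trperp (u :: us).
  rewrite trperp_cons (trperp_addset us).2 ?trperpZ // andbT.
  by rewrite mulrBr raddfB /= mulrCA (trKZ _ Kd) divfK // subrr.
have Kc : c \in K by rewrite fixfieldM ?fixfieldV ?trK_fix.
rewrite mulrBr raddfB /= mulrCA (trKZ _ Kd) => e.
rewrite mulrBl raddfB /= -mulrA (trKZ _ Kc) -[RHS]e; congr (_ - _).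
by rewrite /c; ring.
Qed.

(** Each condition has values in [K], so it divides the cardinality by at most [q]. *)
Lemma card_trperp us : (#|F| <= #|trperp us| * q ^ size us)%N.
Proof.
elim: us => [|u us IH].
  by rewrite expn0 muln1 (_ : trperp _ = setT) ?cardsT //; apply/setP=> x; rewrite !inE.
apply: leq_trans IH _.
have gB : {morph (fun x => trK (u * x)) : x y / x - y}.
  by move=> x y; rewrite mulrBr raddfB.
rewrite (card_addset_fibers (trperp_addset us) gB) expnS mulnA leq_mul // mulnC leq_mul //.
  by apply: subset_leq_card; apply/subsetP=> x; rewrite trperp_cons inE andbC.
by apply: subset_leq_card; apply/subsetP=> _ /imsetP[x _ ->]; apply: trK_fix.
Qed.

(** * Bivectors as operators *)

Definition wedge_coef (us ws : seq F) l :=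
  \sum_(p <- zip us ws) (p.1 * siter s l p.2 + p.2 * siter s l p.1).

(* The operator of the bivector [sum_i u_i /\ w_i] for the trace form (in
   characteristic 2); it vanishes identically iff the bivector is zero. *)
Definition wedge_op (us ws : seq F) x :=
  \sum_(p <- zip us ws) (p.1 * trK (p.2 * x) + p.2 * trK (p.1 * x)).

Lemma wedge_opE us ws x : wedge_op us ws x = spoly s (wedge_coef us ws) M x.
Proof.
rewrite /spoly /wedge_coef; under [RHS]eq_bigr do rewrite mulr_suml.
rewrite exchange_big /=; apply: eq_bigr => -[u w] _ /=.
rewrite /trK !mulr_sumr -big_split /=; apply: eq_bigr => l _.
by rewrite !rmorphM; ring.
Qed.

Lemma wedge_op_cons u us w ws x :
  wedge_op (u :: us) (w :: ws) x = u * trK (w * x) + w * trK (u * x) + wedge_op us ws x.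
Proof. by rewrite /wedge_op /= big_cons. Qed.

Definition wedge_eq0 us ws := [forall x, wedge_op us ws x == 0].

Definition ladd (v w : seq F) := [seq p.1 + p.2 | p <- zip v w].

Lemma wedge_op_ladd us v w : size v = size us -> size w = size us ->
  forall x, wedge_op us (ladd v w) x = wedge_op us v x + wedge_op us w x.
Proof.
move=> sv sw x; elim: us v w sv sw => [|u us IH] [|v vs] [|w ws] //=.
  by rewrite /wedge_op !big_nil addr0.
move=> [sv] [sw]; rewrite [ladd _ _]/= -/(ladd vs ws) !wedge_op_cons IH //.
by rewrite mulrDl raddfD /=; ring.
Qed.

(** On vectors orthogonal to [us] only the terms [u_i * trK (w_i * x)] survive. *)
Lemma wedge_op_span us ws x : size ws = size us -> x \in trperp us -> wedge_op us ws x \in span us.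
Proof.
elim: us ws => [|u us IH] [|w ws] //=; first by move=> *; rewrite /wedge_op big_nil inE.
case=> sws; rewrite trperp_cons => /andP[/eqP ux ox].
apply/span_consP; exists (trK (w * x)); first exact: trK_fix.
by rewrite wedge_op_cons ux mulr0 addr0 addrAC [u * _]mulrC subrr add0r IH.
Qed.

(** If [v = sum_i c_i u_i], then [u /\ v] is [sum_i u_i /\ (c_i u)] in characteristic 2; the witness
    lists the [c_i * u]. *)
Lemma wedge_op_shift u us v : v \in span us ->
  exists2 w0, size w0 = size us & forall x, wedge_op us w0 x = u * trK (v * x) + v * trK (u * x).
Proof.
elim: us v => [|u1 us IH] v.
  rewrite inE => /eqP->; exists [::] => // x.
  by rewrite /wedge_op big_nil !mul0r raddf0 mulr0 addr0.
case/span_consP=> c Kc /IH[w0 sw0 hw0]; exists (c * u :: w0) => /= [|x]; first by rewrite sw0.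
rewrite wedge_op_cons hw0 mulrBl raddfB /= -!mulrA !(trKZ _ Kc).
by ring.
Qed.

(** * Sums over lists of vectors and over independent lists *)

Fixpoint listsum t (f : seq F -> rat) : rat :=
  if t is t'.+1 then \sum_w listsum t' (fun ws => f (w :: ws)) else f [::].

Lemma eq_listsum t f g : (forall ws, size ws = t -> f ws = g ws) -> listsum t f = listsum t g.
Proof.
elim: t f g => [|t IH] f g fg /=; first exact: fg.
by apply: eq_bigr => w _; apply: IH => ws sws; apply: fg; rewrite /= sws.
Qed.

Lemma listsum0 t : listsum t (fun=> 0) = 0.
Proof. by elim: t => //= t IH; rewrite big1. Qed.

Lemma listsum_ladd t f w0 : size w0 = t -> listsum t (fun ws => f (ladd ws w0)) = listsum t f.
Proof.
elim: t f w0 => [|t IH] f [|w w0] //= [sw0].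
rewrite [RHS](reindex_inj (addIr w)) /=; apply: eq_bigr => v _.
exact: (IH (fun ws => f (v + w :: ws)) w0 sw0).
Qed.

(* A relation [u /\ w + sum_i u_i /\ w_i = 0] with [u :: us] independent puts [w] in
   the span of [u :: us]; for each such [w], translating the [w_i] reduces to the
   relations on [us]. *)
Lemma listsum_wedge_eq0 us : indep us ->
  listsum (size us) (fun ws => (wedge_eq0 us ws)%:R) = \prod_(j < size us) (q%:R : rat) ^+ j.+1.
Proof.
elim: us => [|u us IH] /=.
  by move=> _; rewrite big_ord0 /wedge_eq0; case: forallP => // -[] x; rewrite /wedge_op big_nil.
case/andP=> hu ius; rewrite big_ord_recr /= -IH // mulrC.
rewrite (bigID (mem (span (u :: us)))) /= [X in _ + X]big1 ?addr0; last first.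
  move=> w hw; rewrite -[RHS](listsum0 (size us)); apply: eq_listsum => ws sws.
  apply/eqP; rewrite pnatr_eq0 eqb0; apply: contra hw => /forallP h0.
  (* At a point orthogonal to [us] but not to [u], the relation can be solved for [w]. *)
  have [x0 ox0 ux0] : exists2 x0, x0 \in trperp us & trK (u * x0) != 0.
    apply/exists_inP; apply: contraR hu => /exists_inPn h.
    by apply: trperp_span => x /h; rewrite negbK => /eqP.
  have [[sp0 spB] spZ] := span_subspace (u :: us).
  have := h0 x0; rewrite wedge_op_cons addrAC addr_eq0 => /eqP e.
  rewrite -(mulKf ux0 w) spZ ?fixfieldV ?trK_fix // mulrC -[_ * _]opprK -e.
  rewrite -sub0r spB //; apply/span_consP; exists (trK (w * x0)); first exact: trK_fix.
  by rewrite addrAC [u * _]mulrC subrr add0r wedge_op_span.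
have card_sp : #|span (u :: us)| = (q ^ (size us).+1)%N by rewrite card_span //= hu.
rewrite -natrX -card_sp -sum1_card natr_sum mulr_suml.
apply: eq_bigr => w /span_consP[c Kc /(wedge_op_shift u)[w0 sw0 hw0]].
rewrite mul1r -(listsum_ladd _ sw0); apply: eq_listsum => ws sws.
congr (nat_of_bool _)%:R; apply/eq_forallb => x.
rewrite wedge_op_cons wedge_op_ladd // hw0 mulrBl raddfB /= -!mulrA !(trKZ _ Kc).
(* [A] is the operator of [u /\ w]. It occurs twice, as does [Z], so both cancel in characteristic
   2. *)
pose A := u * trK (w * x) + w * trK (u * x); pose Z := c * u * trK (u * x).
rewrite (_ : _ + (_ + _) = wedge_op us ws x + (A + A) - (Z + Z)).
  by rewrite !char2 addr0 subr0.
by rewrite /A /Z; ring.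
Qed.

(* Sums over the extensions of the independent list [us] by [t] further independent vectors,
   added at the head. *)
Fixpoint indsum t (us : seq F) (f : seq F -> rat) : rat :=
  if t is t'.+1 then \sum_(u | u \notin span us) indsum t' (u :: us) f else f us.

Lemma eq_indsum t us f g : indep us ->
  (forall vs, indep vs -> size vs = (size us + t)%N -> f vs = g vs) ->
  indsum t us f = indsum t us g.
Proof.
elim: t us => [|t IH] us ius fg /=; first by apply: fg; rewrite ?addn0.
apply: eq_bigr => u hu; apply: IH; first by rewrite /= hu.
by move=> vs ivs /= svs; apply: fg; rewrite // svs addnS.
Qed.

Lemma indsum_sum (I : finType) (P : pred I) t us (f : I -> seq F -> rat) :
  indsum t us (fun vs => \sum_(i | P i) f i vs) = \sum_(i | P i) indsum t us (f i).
Proof.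
elim: t us => //= t IH us; rewrite exchange_big /=.
by apply: eq_bigr => u _.
Qed.

Lemma indsumZ t us c f : indsum t us (fun vs => c * f vs) = c * indsum t us f.
Proof.
elim: t us => //= t IH us; rewrite mulr_sumr; apply: eq_bigr => u _; exact: IH.
Qed.

(** The next vector must lie in [S] outside the current span, which leaves [#|S|] minus a power of
    [q] choices; lists that leave [S] contribute zero. *)
Lemma indsum_subspace S t us : subspace S -> indep us ->
  indsum t us (fun vs => (all [in S] vs)%:R) =
  (all [in S] us)%:R * \prod_(j < t) (#|S|%:R - q%:R ^+ (size us + j)).
Proof.
move=> hS; elim: t us => [|t IH] us ius /=; first by rewrite big_ord0 mulr1.
under eq_bigr => u hu do rewrite IH /= ?hu //.
rewrite big_ord_recl addn0 mulrA -mulr_suml; congr (_ * _); last first.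
  by apply: eq_bigr => i _; rewrite /= addSnnS.
have [/allP usS|_] := boolP (all [in S] us); last first.
  by rewrite mul0r big1 // => u _; rewrite andbF.
rewrite mul1r; under eq_bigr do rewrite andbT.
rewrite -natrX -(card_span ius) -natrB; last exact: subset_leq_card (introT subsetP (span_min hS usS)).
have -> : (#|S| - #|span us|)%N = #|S :\: span us|.
  rewrite cardsD (setIidPr _) //; apply/subsetP; exact: span_min.
rewrite -sum1_card natr_sum big_mkcond [RHS]big_mkcond /=; apply: eq_bigr => u _.
by rewrite in_setD; case: (u \in span us); case: (u \in S).
Qed.

Lemma indsum_const t (c : rat) :
  indsum t [::] (fun=> c) = c * \prod_(j < t) (#|F|%:R - q%:R ^+ j).
Proof.
transitivity (c * indsum t [::] (fun vs => (all [in [set: F]] vs)%:R)).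
  rewrite -indsumZ; apply: eq_indsum => // vs _ _.
  by rewrite (_ : all _ _ = true) ?mulr1 //; apply/allP=> x _; rewrite inE.
congr (_ * _); rewrite indsum_subspace //=; last first.
  by split=> [|c' x]; rewrite ?inE //; split=> [|x y]; rewrite ?inE.
by rewrite mul1r cardsT.
Qed.


End FixedSpaces.

Lemma trK_addn (F : finFieldType) (s : {rmorphism F -> F}) a b x :
  trK s (a + b) x = trK s a x + trK s b (siter s a x).
Proof.
rewrite /trK big_split_ord /=; congr (_ + _); apply: eq_bigr => i _.
by rewrite addnC siterD.
Qed.

Lemma trK_double (F : finFieldType) (s : {rmorphism F -> F}) N x :
  (forall y : F, y + y = 0) -> siter s N x = x -> trK s (2 * N) x = 0.
Proof. by move=> char2 xN; rewrite mul2n -addnn trK_addn xN char2. Qed.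

(** * Radicals of alternating forms *)

Section AlternatingForms.

Variables (F : finFieldType) (s : {rmorphism F -> F}) (B : F -> F -> F).
Local Notation K := (fixfield s).
Local Notation q := (#|fixfield s|).

(** A nonzero [K]-linear form maps [S] onto [K], so its kernel has index [q]. *)
Lemma card_ker_form (S : {set F}) (g : F -> F) :
  subspace s S -> {morph g : x y / x - y} ->
  (forall c x, c \in K -> g (c * x) = c * g x) -> (forall x, g x \in K) ->
  (exists2 y, y \in S & g y != 0) ->
  #|S| = (q * #|[set x in S | g x == 0%R]|)%N /\ subspace s [set x in S | g x == 0].
Proof.
move=> [hS hZ] gB gZ gK [y Sy gy]; split.
  rewrite (card_addset_fibers hS gB); congr (_ * _)%N; apply: eq_card => c.
  apply/imsetP/idP=> [[x _ ->]|Kc]; first exact: gK.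
  have Kd : c / g y \in K by rewrite fixfieldM ?fixfieldV.
  by exists (c / g y * y); [exact: hZ | rewrite gZ // divfK].
have g0 : g 0 = 0 by have := gB 0 0; rewrite !subrr.
split; first split.
- by rewrite inE g0 eqxx andbT; case: hS.
- move=> x z; rewrite !inE => /andP[Sx /eqP gx] /andP[Sz /eqP gz].
  by rewrite gB gx gz subrr eqxx andbT hS.2.
- move=> c x Kc; rewrite !inE => /andP[Sx /eqP gx].
  by rewrite gZ // gx mulr0 eqxx hZ.
Qed.

Hypothesis Bsym : forall x y, B x y = B y x.
Hypothesis Balt : forall x, B x x = 0.
Hypothesis BB : forall x, {morph B x : y z / y - z}.
Hypothesis BZ : forall x c y, c \in K -> B x (c * y) = c * B x y.
Hypothesis BK : forall x y, B x y \in K.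

Definition radical (S : {set F}) := [set x in S | [forall (y | y \in S), B x y == 0]].

Lemma radicalP (S : {set F}) x :
  reflect (x \in S /\ {in S, forall y, B x y = 0}) (x \in radical S).
Proof.
rewrite inE; apply: (iffP andP) => -[Sx h]; split=> //.
  by move=> y Sy; apply/eqP/(forall_inP h).
by apply/forall_inP => y /h ->.
Qed.

(* Splitting off a hyperbolic plane divides the cardinality by [q ^ 2] and does not
   change the radical. *)
Lemma card_radical (S : {set F}) : subspace s S ->
  exists r, #|S| = (q ^ (2 * r) * #|radical S|)%N.
Proof.
have [u] := ubnP #|S|; elim: u S => // u IH S Su hS.
have [/exists_inP[x Sx /exists_inP[y Sy xy]]|h] :=
  boolP [exists (x | x \in S), exists (y | y \in S), B x y != 0]; last first.
  exists 0%N; rewrite muln0 mul1n; apply: eq_card => x; rewrite inE.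
  apply/idP/andP=> [Sx|[]//]; split=> //; apply/forall_inP=> y Sy.
  by apply: contraR h => xy; apply/exists_inP; exists x => //; apply/exists_inP; exists y.
have [e1 hS1] := card_ker_form hS (BB x) (BZ x) (BK x) (ex_intro2 _ _ y Sy xy).
set S1 := [set z in S | _] in e1 hS1.
have S1x : x \in S1 by rewrite inE Sx Balt eqxx.
have yx : B y x != 0 by rewrite Bsym.
have [e2 hS2] := card_ker_form hS1 (BB y) (BZ y) (BK y) (ex_intro2 _ _ x S1x yx).
set S2 := [set z in S1 | _] in e2 hS2.
have S20 : (0 < #|S2|)%N by rewrite card_gt0; apply/set0Pn; exists 0; case: hS2 => -[].
have q1 := card_fixfield_gt1 s.
have cS : #|S| = (q ^ 2 * #|S2|)%N by rewrite e1 e2 mulnA.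
have [|r er] := IH S2 _ hS2.
  rewrite ltnS in Su; apply: leq_trans Su; rewrite cS -[X in (X < _)%N]mul1n ltn_mul2r S20 /=.
  by rewrite -[1%N](exp1n 2) ltn_exp2r.
exists r.+1; rewrite cS er mulnA -expnD mulnS; congr (_ * _)%N.
apply: eq_card => z; apply/radicalP/radicalP => -[].
  rewrite !inE => /andP[/andP[Sz /eqP xz] /eqP yz] hz; split=> // w Sw.
  (* [w - a * x - b * y] is the component of [w] orthogonal to the plane of [x] and [y]. *)
  pose b := B x w / B x y; pose a := B y w / B y x.
  have Kb : b \in K by rewrite fixfieldM ?fixfieldV ?BK.
  have Ka : a \in K by rewrite fixfieldM ?fixfieldV ?BK.
  have Sw' : w - a * x - b * y \in S2.
    rewrite !inE !BB !BZ // !Balt /a /b !divfK // mulr0 !subr0 subrr eqxx andbT.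
    rewrite mulr0 subr0 subrr eqxx andbT.
    by case: hS => hS hZ; rewrite !hS.2 // hZ.
  have := hz _ Sw'; rewrite !BB !BZ // ![B z _]Bsym.
  by rewrite xz yz !mulr0 !subr0 (Bsym w).
move=> Sz hz; split; last by move=> w; rewrite !inE => /andP[/andP[Sw _] _]; apply: hz.
by rewrite !inE Sz ![B _ z]Bsym !hz ?eqxx.
Qed.

End AlternatingForms.

(** * Change of basis for the moments *)

Section MomentInversion.

Variables (R : fieldType) (q : R).
Hypothesis q_neq0 : q != 0.

(** [qfall t x] counts the independent [t]-lists in a space of [x] elements, and [qmoment t] at
    [1 / #|F|] will be its average over the radicals. [qfall2] is the Newton basis adapted to even
    dimensions, with nodes [q ^ (2 j)]. *)
Definition qfall t (x : R) := \prod_(j < t) (x - q ^+ j).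
Definition qfall2 v (x : R) := \prod_(j < v) (x - q ^+ (2 * j)).
Definition qmoment t (y : R) := \prod_(j < t) (q ^+ j.+1 * (1 - q ^+ j * y)).
Definition qmoment2 v (y : R) := q ^+ v * \prod_(j < v) (1 - q ^+ (2 * j) * y).

(** Replacing [y] by [q ^ 2 * y] moves the window of factors by two places. The form without
    division allows vanishing factors. *)
Lemma qmoment_shift t y :
  qmoment t (q ^+ 2 * y) * ((1 - y) * (1 - q * y)) =
  qmoment t y * ((1 - q ^+ t * y) * (1 - q ^+ t.+1 * y)).
Proof.
elim: t => [|t IH]; first by rewrite /qmoment !big_ord0 expr0 expr1 !mul1r.
rewrite /qmoment !big_ord_recr /= -!/(qmoment t _) mulrAC IH !exprS.
by ring.
Qed.

Lemma qmoment2_shift v y :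
  qmoment2 v (q ^+ 2 * y) * (1 - y) = qmoment2 v y * (1 - q ^+ (2 * v) * y).
Proof.
rewrite /qmoment2; elim: v => [|v IH]; first by rewrite !big_ord0 muln0 expr0 !mul1r.
have {}IH : \prod_(j < v) (1 - q ^+ (2 * j) * (q ^+ 2 * y)) * (1 - y) =
    \prod_(j < v) (1 - q ^+ (2 * j) * y) * (1 - q ^+ (2 * v) * y).
  by apply: (mulfI (expf_neq0 v q_neq0)); rewrite !mulrA.
rewrite !big_ord_recr /= -mulrA [_ * (1 - y)]mulrAC IH mulnS exprD.
by ring.
Qed.

Lemma qmoment2V v y : y != 0 -> qmoment2 v y^-1 = q ^+ v / y ^+ v * qfall2 v y.
Proof.
move=> y0; rewrite /qmoment2 -mulrA; congr (_ * _).
apply: (mulfI (expf_neq0 v y0)); rewrite mulVKf ?expf_neq0 //.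
have -> : y ^+ v = \prod_(j < v) y by rewrite prodr_const card_ord.
rewrite -big_split /=.
by apply: eq_bigr => j _; field.
Qed.

(* The linear functional sending [qfall t] to [qmoment t y] sends [qfall2 v] to
   [qmoment2 v y].  Multiplication by the variable corresponds to the operator
   [g |-> (g y - (1 - y) (1 - q y) g (q^2 y)) / y] on functions of [y]; applying it
   to both families gives the induction on [v]. *)
Lemma qfall2_expansion v : exists c : nat -> R,
  (forall x, qfall2 v x = \sum_(t < v.+1) c t * qfall t x) /\
  (forall y, y != 0 -> qmoment2 v y = \sum_(t < v.+1) c t * qmoment t y).
Proof.
elim: v => [|v [c [cx cy]]].
  exists (fun=> 1); split=> [x|y _]; rewrite big_ord1.
    by rewrite /qfall /qfall2 !big_ord0 mulr1.
  by rewrite /qmoment /qmoment2 !big_ord0 !mulr1.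
(* From [(x - q ^ (2 v)) qfall t = qfall (t + 1) + (q ^ t - q ^ (2 v)) qfall t]. *)
pose c' t := (if t is t'.+1 then c t' else 0) +
             (if (t <= v)%N then (q ^+ t - q ^+ (2 * v)) * c t else 0).
have c'E (h : nat -> R) : \sum_(t < v.+2) c' t * h t =
    \sum_(t < v.+1) c t * (h t.+1 + q ^+ t * h t - q ^+ (2 * v) * h t).
  under eq_bigr do rewrite mulrDl; rewrite big_split /=.
  rewrite big_ord_recl mul0r add0r [X in _ + X]big_ord_recr /= ltnn mul0r addr0.
  rewrite -big_split /=; apply: eq_bigr => t _.
  by rewrite -ltnS ltn_ord; ring.
exists c'; split=> [x|y y0]; [rewrite (c'E (qfall^~ x)) | rewrite (c'E (qmoment^~ y))].
  rewrite /qfall2 big_ord_recr /= -/(qfall2 v x) cx mulr_suml; apply: eq_bigr => t _.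
  by rewrite /qfall big_ord_recr /=; ring.
pose D (g : R -> R) := (g y - g (q ^+ 2 * y) * ((1 - y) * (1 - q * y))) / y.
have DM t : qmoment t.+1 y + q ^+ t * qmoment t y = D (qmoment t).
  rewrite /D qmoment_shift /qmoment big_ord_recr /= -/(qmoment t y) !exprS.
  by field.
have Df : qmoment2 v.+1 y = D (qmoment2 v) - q ^+ (2 * v) * qmoment2 v y.
  rewrite /D mulrA qmoment2_shift /qmoment2 big_ord_recr /= exprS.
  by field.
rewrite Df /D [in X in X / y]cy // [in X in X / y]cy ?mulf_neq0 ?expf_neq0 // cy //.
rewrite mulr_suml -sumrB mulr_suml mulr_sumr -sumrB; apply: eq_bigr => t _.
by rewrite DM /D; field.
Qed.

(** Newton interpolation of [1 / x] at the nodes [q ^ (2 j)]; terms with [v > i] vanish. For the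
    induction on [i], the factor [j = 0] is taken out and the other factors are rescaled by
    [q ^ 2]. *)
Lemma qfall2_inverse i k : (i < k)%N ->
  (q ^+ (2 * i))^-1 =
  \sum_(v < k) (-1) ^+ v / q ^+ (v * v.+1) * qfall2 v (q ^+ (2 * i)).
Proof.
elim: i k => [|i IH] [|k] // ik; rewrite big_ord_recl.
  rewrite big1 => [|v _]; last first.
    by rewrite /qfall2 big_ord_recl muln0 subrr mul0r mulr0.
  by rewrite /qfall2 big_ord0 mul0n muln0 !expr0 invr1 !mulr1 addr0.
rewrite (eq_bigr (fun v : 'I_k => - (q ^+ (2 * i.+1) - 1) / q ^+ 2 *
    ((-1) ^+ v / q ^+ (v * v.+1) * qfall2 v (q ^+ (2 * i))))); last first.
  move=> v _; rewrite /= /bump /= add1n /qfall2 big_ord_recl /= muln0 expr0.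
  rewrite (eq_bigr (fun j : 'I_v => q ^+ 2 * (q ^+ (2 * i) - q ^+ (2 * j)))).
    rewrite (prodrMl (mem 'I_v)) card_ord.
    have -> : (v.+1 * v.+2 = v * v.+1 + (v.*2).+2)%N by lia.
    rewrite exprD exprS -!exprM -muln2 [(v * 2)%N]mulnC !exprS.
    by field; rewrite q_neq0 !expf_neq0.
  by move=> j _; rewrite /bump /= add1n !mulnS !exprD mulrBr.
rewrite -mulr_sumr -IH // /qfall2 big_ord0 mulr1 expr0 mul0n expr0 invr1 mulnS exprD.
by field; rewrite q_neq0 !expf_neq0.
Qed.

End MomentInversion.

(** * The forms attached to coefficient vectors *)

Lemma sum_shift_periodic (V : zmodType) (P h : nat) (G : nat -> V) :
  (forall l, G (P + l)%N = G l) -> \sum_(l < P) G (h + l)%N = \sum_(l < P) G l.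
Proof.
move=> GP; elim: h => [|h <-]; first by apply: eq_bigr.
case: P GP => [|P] GP; first by rewrite !big_ord0.
rewrite [LHS]big_ord_recr [RHS]big_ord_recl addrC /= addn0; congr (_ + _).
  by apply: eq_bigr => i _; rewrite /bump /= add1n addnS.
by rewrite -[RHS]GP; congr G; lia.
Qed.

Lemma mem_zip (S R : eqType) (us : seq S) (ws : seq R) p :
  p \in zip us ws -> (p.1 \in us) && (p.2 \in ws).
Proof.
elim: us ws => [|u us IH] [|w ws] //=; rewrite !inE => /predU1P[->|/IH/andP[-> ->]].
  by rewrite !eqxx.
by rewrite !orbT.
Qed.

Section CoefficientFamily.

Variables (F : finFieldType) (s : {rmorphism F -> F}) (N k : nat).
Hypothesis k_gt0 : (0 < k)%N.
Hypothesis k_leN : (k <= N)%N.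
Hypothesis siter2N : forall x : F, siter s (2 * N) x = x.
Hypothesis cardF : #|F| = (#|fixfield s| ^ (2 * N))%N.
Hypothesis char2 : forall x : F, x + x = 0.

Local Notation K := (fixfield s).
Local Notation q := (#|fixfield s|).
Local Notation T := (trK s (2 * N)).

Let q1 : (1 < q)%N := card_fixfield_gt1 s.
Let M0 : (0 < 2 * N)%N. Proof. by move: k_gt0 k_leN; lia. Qed.

(** [siter s (N + j) (a j * x)] is the trace adjoint of [a j * siter s (N - j) x]; the term in [a 0]
    is self-adjoint when [s ^ N] fixes [a 0]. *)
Definition Lmap (a : nat -> F) (x : F) :=
  a 0%N * siter s N x
  + \sum_(1 <= j < k) (a j * siter s (N - j) x + siter s (N + j) (a j * x)).

Fact Lmap_is_zmod_morphism a : zmod_morphism (Lmap a).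
Proof.
move=> x y; rewrite /Lmap rmorphB mulrBr opprD addrACA -sumrB; congr (_ + _).
by apply: eq_bigr => j _; rewrite mulrBr !rmorphB /= mulrBr; ring.
Qed.
HB.instance Definition _ a := GRing.isZmodMorphism.Build F F (Lmap a) (Lmap_is_zmod_morphism a).

Lemma LmapZ a c x : c \in K -> Lmap a (c * x) = c * Lmap a x.
Proof.
move=> Kc; rewrite /Lmap mulrDr mulr_sumr !rmorphM /= (siter_fix _ Kc) mulrCA.
congr (_ + _); apply: eq_bigr => j _.
by rewrite mulrCA !rmorphM /= !(siter_fix _ Kc); ring.
Qed.

Lemma siterB j x : (j <= N)%N -> siter s (N - j) (siter s (N + j) x) = x.
Proof.
by move=> jN; rewrite -siterD addnCA subnK // addnn -mul2n siter2N.
Qed.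

Section InvariantFunctional.

Variables (V : zmodType) (f : {additive F -> V}).
Hypothesis f_inv : forall y, f (s y) = f y.

Lemma invariant_siter l y : f (siter s l y) = f y.
Proof. by elim: l => // l IH; rewrite siterS f_inv. Qed.

(** Invariance lets [s ^ (N - j)] be applied to the adjoint terms. This serves both the trace to [K]
    and the absolute trace. *)
Lemma invariant_mul_Lmap a w u : f (w * Lmap a u) =
  f (a 0%N * (w * siter s N u)
     + \sum_(1 <= j < k) a j * (w * siter s (N - j) u + u * siter s (N - j) w)).
Proof.
rewrite /Lmap mulrDr mulr_sumr !raddfD !raddf_sum; congr (_ + _).
  by rewrite mulrCA.
apply: eq_big_nat => j /andP[_ jk]; rewrite !mulrDr !raddfD; congr (_ + _).
  by rewrite mulrCA.
rewrite -(invariant_siter (N - j)) rmorphM /= siterB; last exact: leq_trans (ltnW jk) k_leN.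
by congr (f _); ring.
Qed.

(* [f (sum_i w_i * L_a u_i)] depends on [u], [w] only through the bivector
   [sum_i u_i /\ w_i]: its coefficients at [s ^ (N - j)] pair with [a j], and the one at
   [s ^ N], which is [wedge_half + s ^ N wedge_half], pairs with [a 0]. *)
Definition wedge_half (us ws : seq F) := \sum_(p <- zip us ws) p.2 * siter s N p.1.
Definition wedge_pair a us ws :=
  a 0%N * wedge_half us ws + \sum_(1 <= j < k) a j * wedge_coef s us ws (N - j).

Lemma invariant_sum_Lmap a us ws :
  f (\sum_(p <- zip us ws) p.2 * Lmap a p.1) = f (wedge_pair a us ws).
Proof.
rewrite raddf_sum; under eq_bigr do rewrite invariant_mul_Lmap.
rewrite -raddf_sum big_split /= -mulr_sumr; congr (f (_ + _)).
rewrite exchange_big /=; apply: eq_bigr => j _; rewrite -mulr_sumr; congr (_ * _).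
by apply: eq_bigr => p _; rewrite addrC.
Qed.

End InvariantFunctional.

(** A nonzero skew polynomial with [r <= 2 * N] terms has fewer than [#|F|] zeros. *)
Lemma spoly_eq0 c r : (r <= 2 * N)%N -> (forall x, spoly s c r x = 0) ->
  forall l, (l < r)%N -> c l = 0.
Proof.
move=> rM h l lr; apply/eqP; apply: contraT => cl.
case: r rM h lr => // r rM h lr.
have := @card_ker_spoly F s c r (ex_intro2 _ _ l lr cl).
rewrite (_ : [set _ | _] = setT); last by apply/setP=> x; rewrite !inE h eqxx.
by rewrite cardsT cardF leq_exp2l // leqNgt rM.
Qed.

Lemma wedge_coefN us ws : wedge_coef s us ws N = wedge_half us ws + siter s N (wedge_half us ws).
Proof.
rewrite /wedge_coef /wedge_half rmorph_sum -big_split /=; apply: eq_bigr => p _.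
by rewrite rmorphM /= -siterD addnn -mul2n siter2N; ring.
Qed.

(** The bivector operator is self-adjoint, so its coefficients at [N + j] and [N - j] determine each
    other. *)
Lemma wedge_coefD us ws j : (j <= N)%N ->
  wedge_coef s us ws (N + j) = siter s (N + j) (wedge_coef s us ws (N - j)).
Proof.
move=> jN; rewrite /wedge_coef rmorph_sum; apply: eq_bigr => p _.
rewrite rmorphD !rmorphM /= -!siterD -addnA subnKC // addnn -mul2n.
by rewrite !siter2N; ring.
Qed.

Lemma card_ker_Lmap a : (exists2 j, (j < k)%N & a j != 0) ->
  (#|[set x | Lmap a x == 0%R]| <= q ^ (2 * k.-1))%N.
Proof using k_gt0 k_leN.
clear cardF siter2N M0.
case=> j jk aj.
(* The exponents of [Lmap] run from [N - (k - 1)] to [N + (k - 1)]. After [s ^ (N - (k - 1))] is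
   split off, index [k - 1 - j] carries the term in [s ^ (N - j)] and [k - 1 + j] the one in
   [s ^ (N + j)]. *)
pose c l := if (l < k)%N then a (k.-1 - l)%N else siter s (N + (l - k.-1)) (a (l - k.-1)%N).
have LE x : Lmap a x = spoly s c (2 * k.-1).+1 (siter s (N - k.-1) x).
  rewrite /Lmap /spoly -(big_mkord xpredT (fun l => c l * siter s l (siter s (N - k.-1) x))).
  rewrite big_split /= addrCA.
  rewrite [RHS](big_cat_nat (n := k.-1)) /=; [|done|lia]; congr (_ + _).
    rewrite [RHS]big_nat_rev /= -{1}(prednK k_gt0) big_add1 /=.
    apply: eq_big_nat => i ik; rewrite /c -siterD ifT; last by lia.
    by congr (a _ * siter s _ _); lia.
  rewrite [RHS]big_ltn; last by lia.
  rewrite {1}/c ifT; last by lia.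
  rewrite subnn -siterD; congr (a _ * siter s _ _ + _); first by lia.
  rewrite -{1}(add1n k.-1) (_ : (2 * k.-1).+1 = (k + k.-1)%N); last by lia.
  rewrite big_addn (_ : (_ - k.-1)%N = k); last by lia.
  apply: eq_big_nat => i ik; rewrite /c ifF; last by lia.
  by rewrite addnK -siterD rmorphM /=; congr (_ * siter s _ _); lia.
have inj : injective (siter s (N - k.-1)) by exact: fmorph_inj.
rewrite -(card_imset _ inj); apply: leq_trans (@card_ker_spoly F s c _ _).
  apply: subset_leq_card; apply/subsetP=> _ /imsetP[x + ->].
  by rewrite !inE LE.
exists (k.-1 - j)%N; first by lia.
rewrite /c ifT; last by lia.
by rewrite subKn //; lia.
Qed.

(** By nondegeneracy of the trace the kernel is the radical of [T (x * Lmap a y)], an alternating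
    form on a space of dimension [2 * N]. *)
Lemma card_ker_Lmap_even a : siter s N (a 0%N) = a 0%N ->
  exists r, #|[set x | Lmap a x == 0%R]| = (q ^ (2 * r))%N.
Proof.
move=> a0; pose B x y := T (x * Lmap a y).
have Bsym x y : B x y = B y x.
  have T_s := trK_s M0 siter2N.
  rewrite /B !(invariant_mul_Lmap T_s) !raddfD /=; congr (_ + _); last first.
    by congr T; apply: eq_bigr => j _; rewrite addrC.
  rewrite -(invariant_siter T_s N) !rmorphM /= -siterD addnn -mul2n siter2N a0.
  by congr T; ring.
(* The terms with [j > 0] double up, and the remaining one is fixed by [s ^ N], hence of trace
   zero. *)
have Balt x : B x x = 0.
  rewrite /B (invariant_mul_Lmap (trK_s M0 siter2N)) raddfD /= big1 => [|j _]; last by rewrite char2 mulr0.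
  rewrite raddf0 addr0; apply: trK_double => //.
  by rewrite !rmorphM /= -siterD addnn -mul2n siter2N a0; ring.
have BB x : {morph B x : y z / y - z} by move=> y z; rewrite /B raddfB mulrBr raddfB.
have BZ x c y : c \in K -> B x (c * y) = c * B x y.
  by move=> Kc; rewrite /B LmapZ // mulrCA trKZ.
have BK x y : B x y \in K by apply: trK_fix.
have hT : subspace s [set: F].
  by split=> [|c x _ _]; rewrite ?inE //; split=> [|x y _ _]; rewrite inE.
have [r] := card_radical Bsym Balt BB BZ BK hT.
rewrite cardsT cardF (_ : radical B _ = [set x | Lmap a x == 0]) => [e|]; last first.
  apply/setP=> x; rewrite !inE /=; apply/forallP/eqP => [h|Lx y]; last first.
    by rewrite inE Bsym /B Lx mulr0 raddf0 eqxx.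
  apply: (trK_nondeg M0 cardF) => y; rewrite mulrC -/(B y x) Bsym.
  by have := h y; rewrite inE => /eqP.
have q0 : (0 < q)%N by apply: ltnW.
have rN : (r <= N)%N.
  rewrite -(leq_pmul2l (isT : (0 < 2)%N)) -(leq_exp2l _ _ q1) e leq_pmulr //.
  by rewrite card_gt0; apply/set0Pn; exists 0; rewrite inE raddf0.
exists (N - r)%N; apply/eqP; rewrite -(eqn_pmul2l (m := q ^ (2 * r))) ?expn_gt0 ?q0 //.
by rewrite -e -expnD -mulnDr subnKC.
Qed.

Variable tr : {additive F -> F}.
Hypothesis tr_s : forall y, tr (s y) = tr y.
Hypothesis tr_fixN : forall y, siter s N y = y -> tr y = 0.
Hypothesis tr_nondeg : forall v, (forall x, tr (v * x) = 0) -> v = 0.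

(** The vanishing coefficient at [s ^ N] makes [wedge_half] fixed by [s ^ N], so [tr] kills its
    product with [a 0]. *)
Lemma wedge_eq0_orthogonal us ws : wedge_eq0 s (2 * N) us ws ->
  forall a, siter s N (a 0%N) = a 0%N -> tr (wedge_pair a us ws) = 0.
Proof.
move=> /forallP h a a0.
have C0 l : (l < 2 * N)%N -> wedge_coef s us ws l = 0.
  by apply: spoly_eq0 => // x; rewrite -wedge_opE; apply/eqP.
rewrite /wedge_pair big_nat big1 ?addr0 => [|j jk]; last by rewrite C0 ?mulr0 //; lia.
apply: tr_fixN; rewrite rmorphM /= a0; congr (_ * _).
have CN : wedge_coef s us ws N = 0 by apply: C0; lia.
by apply: (addrI (wedge_half us ws)); rewrite -wedge_coefN CN char2.
Qed.

Lemma orthogonal_wedge_eq0 us ws : size ws = size us -> (size us < k)%N ->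
  (forall a, siter s N (a 0%N) = a 0%N -> tr (wedge_pair a us ws) = 0) ->
  wedge_eq0 s (2 * N) us ws.
Proof.
move=> sws usk h.
(* Test vectors with a single nonzero coefficient isolate each [wedge_coef]. *)
pose dl j c (i : nat) : F := if i == j then c else 0.
have Cm j : (0 < j < k)%N -> wedge_coef s us ws (N - j) = 0.
  move=> /andP[j0 jk]; apply: tr_nondeg => x; rewrite mulrC.
  have := h (dl j x); rewrite /wedge_pair /dl ifF ?rmorph0; last by lia.
  move=> /(_ erefl); rewrite mul0r add0r (bigD1_seq j) ?iota_uniq ?mem_index_iota ?j0 //=.
  by rewrite eqxx big1 ?addr0 // => i /negPf ij; rewrite ij mul0r.
have CN : wedge_coef s us ws N = 0.
  apply: tr_nondeg => b; rewrite wedge_coefN.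
  (* [b + s ^ N b] is an admissible value of [a 0], and pairing it with [wedge_half] gives the trace
     of [b] times the coefficient at [s ^ N]. *)
  have := h (dl 0%N (b + siter s N b)); rewrite /wedge_pair /dl eqxx.
  rewrite rmorphD /= -siterD addnn -mul2n siter2N addrC => /(_ erefl).
  rewrite big_nat big1 ?addr0 => [|j jk]; last by rewrite ifF ?mul0r //; lia.
  move=> <-; rewrite mulrDl mulrDl !raddfD mulrC; congr (_ + _).
  by rewrite -(invariant_siter tr_s N) rmorphM /= -siterD addnn -mul2n siter2N mulrC.
have Cp j : (0 < j < k)%N -> wedge_coef s us ws (N + j) = 0.
  by move=> jk; rewrite wedge_coefD ?Cm ?rmorph0 //; lia.
have Cw l : (N - k < l < N + k)%N -> wedge_coef s us ws l = 0.
  move=> hl; have [lN|lN|->//] := ltngtP l N.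
    by rewrite (_ : l = (N - (N - l))%N) ?Cm //; lia.
  by rewrite (_ : l = (N + (l - N))%N) ?Cp //; lia.
(* The surviving exponents form one cyclic window modulo [2 * N], from [N + k] to [N - k + 2 * N],
   hence degree [2 * (N - k)]. *)
pose c l := wedge_coef s us ws (N + k + l).
have wE x : wedge_op s (2 * N) us ws x = spoly s c (2 * (N - k)).+1 (siter s (N + k) x).
  rewrite wedge_opE /spoly.
  rewrite -(sum_shift_periodic (N + k) (G := fun l => wedge_coef s us ws l * siter s l x));
    last first.
    move=> l; rewrite (siterD s (2 * N) l) siter2N; congr (_ * _); apply: eq_bigr => p _.
    by rewrite !(siterD s (2 * N) l) !siter2N.
  rewrite (big_ord_widen_cond (2 * N) xpredT
    (fun l => c l * siter s l (siter s (N + k) x))) /=; last by lia.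
  rewrite [RHS]big_mkcond /=; apply: eq_bigr => l _; case: ifPn => hl.
    by rewrite -siterD [(l + _)%N]addnC.
  have -> : wedge_coef s us ws (N + k + l) = wedge_coef s us ws (N + k + l - 2 * N).
    rewrite -[in LHS](subnKC (_ : 2 * N <= N + k + l)%N); last by lia.
    by apply: eq_bigr => p _; rewrite !(siterD s (2 * N)) !siter2N.
  by rewrite Cw ?mul0r //; have := ltn_ord l; lia.
have [/existsP[l cl]|/existsPn c0] := boolP [exists l : 'I_(2 * (N - k)).+1, c l != 0]; last first.
  apply/forallP => x; rewrite wE /spoly big1 // => l _.
  by have := c0 l; rewrite negbK => /eqP ->; rewrite mul0r.
have lr : (l <= 2 * (N - k))%N by rewrite -ltnS.
have := @card_ker_spoly F s c _ (ex_intro2 (fun l => l <= 2 * (N - k))%N (fun l => c l != 0) _ lr cl).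
have inj : injective (siter s (N + k)) by exact: fmorph_inj.
(* The operator vanishes on the vectors orthogonal to [us ++ ws], at least
   [q ^ (2 * N - 2 * size us)] of them: too many for this degree, as [size us < k]. *)
move=> hle; have := card_trperp M0 siter2N (us ++ ws).
rewrite size_cat sws addnn -mul2n cardF leqNgt; case/negP.
have : (#|trperp s (2 * N) (us ++ ws)| <= q ^ (2 * (N - k)))%N.
  apply: leq_trans hle; rewrite -(card_imset _ inj); apply: subset_leq_card.
  apply/subsetP=> _ /imsetP[x + ->]; rewrite !inE -wE => /allP ox.
  apply/eqP; rewrite /wedge_op big_seq big1 // => p pz.
  have /andP[pu pw] := mem_zip pz.
  by rewrite !(eqP (ox _ _)) ?mulr0 ?addr0 // mem_cat ?pu ?pw ?orbT.
move=> hle2; apply: leq_ltn_trans (leq_mul hle2 (leqnn _)) _.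
by rewrite -expnD ltn_exp2l //; lia.
Qed.

End CoefficientFamily.

(** * Moments and exponential sums *)

HB.saturate (@finfun_of).

(** Translating by [x0] multiplies the sum by [h x0], so it vanishes unless [h] is trivial on
    [A]. *)
Lemma char_sum (V : finZmodType) (A : {set V}) (h : V -> rat) : addset A ->
  {in A &, {morph h : x y / x + y >-> x * y}} ->
  \sum_(x in A) h x = if [forall (x | x \in A), h x == 1] then #|A|%:R else 0.
Proof.
move=> hA hD; case: forall_inP => [h1|/forall_inP].
  rewrite (eq_bigr (fun=> 1)) => [|x /h1/eqP //]; by rewrite sumr_const.
rewrite negb_forall => /existsP[x0]; rewrite negb_imply => /andP[Ax0 hx0].
have e : \sum_(x in A) h x = h x0 * \sum_(x in A) h x.
  rewrite [LHS](reindex_inj (addIr x0)) /= mulr_sumr.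
  apply: eq_big => [x|x]; first by rewrite addsetDr.
  by rewrite addsetDr // => Ax; rewrite hD // mulrC.
apply/eqP; move/eqP: e; rewrite -subr_eq0 -{1}[\sum_(x in A) h x]mul1r -mulrBl mulf_eq0.
by rewrite subr_eq0 eq_sym (negPf hx0).
Qed.

Section ListSums.
Variable F : finFieldType.

Lemma listsumZ t c (f : seq F -> rat) : listsum t (fun ws => c * f ws) = c * listsum t f.
Proof.
elim: t f => //= t IH f; rewrite mulr_sumr; apply: eq_bigr => w _; exact: IH.
Qed.

Lemma listsum_sum (I : finType) (P : pred I) t (f : I -> seq F -> rat) :
  listsum t (fun ws => \sum_(i | P i) f i ws) = \sum_(i | P i) listsum t (f i).
Proof.
elim: t f => //= t IH f; rewrite exchange_big /=; apply: eq_bigr => w _; exact: IH.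
Qed.
End ListSums.

Definition sgn2 (F : finFieldType) (u : F) : rat := if u == 0 then 1 else -1.

Lemma sgn2_0 (F : finFieldType) : sgn2 (0 : F) = 1.
Proof. by rewrite /sgn2 eqxx. Qed.

Lemma sgn2_1 (F : finFieldType) : sgn2 (1 : F) = -1.
Proof. by rewrite /sgn2 oner_eq0. Qed.

Lemma sgn2D (F : finFieldType) (u v : F) : (forall x : F, x + x = 0) ->
  u = 0 \/ u = 1 -> v = 0 \/ v = 1 -> sgn2 (u + v) = sgn2 u * sgn2 v.
Proof.
move=> char2; case=> -> [] ->; rewrite ?addr0 ?add0r ?char2 ?sgn2_0 ?sgn2_1;
  by rewrite ?mulrNN ?mul1r ?mulr1.
Qed.

Section Moments.

Variables (F : finFieldType) (s : {rmorphism F -> F}) (N k : nat).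
Hypothesis k_gt0 : (0 < k)%N.
Hypothesis k_leN : (k <= N)%N.
Hypothesis siter2N : forall x : F, siter s (2 * N) x = x.
Hypothesis cardF : #|F| = (#|fixfield s| ^ (2 * N))%N.
Hypothesis char2 : forall x : F, x + x = 0.
Variable tr : {additive F -> F}.
Hypothesis tr_s : forall y, tr (s y) = tr y.
Hypothesis tr_fixN : forall y, siter s N y = y -> tr y = 0.
Hypothesis tr_nondeg : forall v, (forall x, tr (v * x) = 0) -> v = 0.
Hypothesis tr01 : forall y, tr y = 0 \/ tr y = 1.

Local Notation q := (#|fixfield s|).
Local Notation X := (#|F|%:R : rat).
Let q1 : (1 < q)%N := card_fixfield_gt1 s.
Let M0 : (0 < 2 * N)%N. Proof. by move: k_gt0 k_leN; lia. Qed.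
Let X0 : X != 0.
Proof. by rewrite pnatr_eq0 -lt0n; apply/card_gt0P; exists 0. Qed.
Let q0 : (q%:R : rat) != 0.
Proof. by rewrite pnatr_eq0 -lt0n ltnW. Qed.

Definition chi (y : F) : rat := sgn2 (tr y).

Lemma chiD x y : chi (x + y) = chi x * chi y.
Proof. by rewrite /chi raddfD sgn2D. Qed.

Lemma chi0 : chi 0 = 1. Proof. by rewrite /chi raddf0 sgn2_0. Qed.

Lemma chi_eq1 y : (chi y == 1) = (tr y == 0).
Proof. by rewrite /chi /sgn2; case: ifP. Qed.

Lemma chi_sum_mul c : \sum_x chi (x * c) = if c == 0 then X else 0.
Proof.
have hA : addset [set: F] by split=> [|x y _ _]; rewrite inE.
rewrite (eq_bigl [in [set: F]]) => [|x]; last by rewrite inE.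
rewrite char_sum // => [|x y _ _]; last by rewrite mulrDl chiD.
rewrite cardsT; congr (if _ then _ else _); apply/forall_inP/eqP => [h|-> x _].
  by apply: tr_nondeg => x; have := h x; rewrite inE chi_eq1 mulrC => /(_ isT)/eqP.
by rewrite mulr0 chi0.
Qed.

Definition coefn (a : {ffun 'I_k.+1 -> F}) (j : nat) : F := a (inord j).
Definition dom := [set a : {ffun 'I_k.+1 -> F} | siter s N (a ord0) == a ord0].
Lemma card_dom : #|dom| = (#|[set y | siter s N y == y]| * #|F| ^ k)%N.
Proof.
pose A (j : 'I_k.+1) : pred F := if j == ord0 then [pred y | siter s N y == y] else predT.
have -> : #|dom| = #|family A|.
  apply: eq_card => a; rewrite inE; apply/idP/familyP => [ha j|/(_ ord0)].
    by rewrite /A; case: eqVneq => [->|].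
  by rewrite /A eqxx.
rewrite card_family foldrE big_image /= big_ord_recl; congr (_ * _)%N.
  by apply: eq_card => y; rewrite /A eqxx !inE.
by rewrite (eq_bigr (fun=> #|F|)) ?prod_nat_const ?card_ord.
Qed.

Definition rad a := [set x | Lmap s N k (coefn a) x == 0].

Lemma inord0 : inord 0 = ord0 :> 'I_k.+1.
Proof. by apply: val_inj; rewrite /= inordK. Qed.

Lemma coefn0 a : a \in dom -> siter s N (coefn a 0) = coefn a 0.
Proof. by rewrite inE /coefn inord0 => /eqP. Qed.

Lemma dom_addset : addset dom.
Proof.
split=> [|a b]; first by rewrite inE ffunE rmorph0.
by rewrite !inE !ffunE rmorphB /= => /eqP-> /eqP->.
Qed.

Lemma wedge_pairD us ws a b :
  wedge_pair s N k (coefn (a + b)) us ws = wedge_pair s N k (coefn a) us ws + wedge_pair s N k (coefn b) us ws.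
Proof.
rewrite /wedge_pair /coefn ffunE mulrDl addrACA -big_split /=; congr (_ + _).
by apply: eq_bigr => j _; rewrite ffunE mulrDl.
Qed.

(** In [a] the summand is a character of [dom], trivial exactly when the bivector vanishes. *)
Lemma chi_sum_dom us ws : size ws = size us -> (size us < k)%N ->
  \sum_(a in dom) chi (\sum_(p <- zip us ws) p.2 * Lmap s N k (coefn a) p.1) =
  #|dom|%:R * (wedge_eq0 s (2 * N) us ws)%:R.
Proof.
move=> sws usk.
under eq_bigr => a _ do rewrite /chi (invariant_sum_Lmap k_leN siter2N tr_s) -/(chi _).
rewrite char_sum; [|exact: dom_addset|by move=> a b _ _; rewrite wedge_pairD chiD].
have -> : [forall (a | a \in dom), chi (wedge_pair s N k (coefn a) us ws) == 1] =
    wedge_eq0 s (2 * N) us ws.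
  apply/forall_inP/idP => [h|h a ad]; last first.
    by rewrite chi_eq1; apply/eqP/(wedge_eq0_orthogonal k_gt0 k_leN siter2N cardF char2 tr_fixN h)/coefn0.
  apply: (orthogonal_wedge_eq0 k_gt0 k_leN siter2N cardF tr_s tr_nondeg) => // a a0.
  pose b : {ffun 'I_k.+1 -> F} := [ffun j => a (val j)].
  have bd : b \in dom by rewrite inE ffunE a0.
  have := h b bd; rewrite chi_eq1 => /eqP <-; congr (tr _); rewrite /wedge_pair.
  rewrite /coefn inord0 ffunE; congr (_ + _); apply: eq_big_nat => j jk.
  by rewrite ffunE /= inordK //; lia.
by case: wedge_eq0; rewrite ?mulr1 ?mulr0.
Qed.

Lemma listsum_chi us (g : F -> F) :
  listsum (size us) (fun ws => chi (\sum_(p <- zip us ws) p.2 * g p.1)) =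
  X ^+ size us * (all (fun u => g u == 0) us)%:R.
Proof.
elim: us => [|u us IH] /=; first by rewrite big_nil chi0 mulr1.
transitivity (\sum_w chi (w * g u) * (X ^+ size us * (all (fun u => g u == 0) us)%:R)).
  apply: eq_bigr => w _; rewrite -IH -listsumZ; apply: eq_listsum => ws _.
  by rewrite big_cons chiD.
rewrite -mulr_suml chi_sum_mul exprS; case: (g u == 0); last by rewrite mul0r mulr0.
by rewrite mulrA.
Qed.

(** Double counting: [listsum_chi] expands the indicator as a sum over [ws]; summing over [a] first
    leaves the relations counted by [listsum_wedge_eq0]. *)
Lemma card_ker_indep us : indep s us -> (size us < k)%N ->
  X ^+ size us * (\sum_(a in dom) (all [in rad a] us)%:R) =
  #|dom|%:R * \prod_(j < size us) q%:R ^+ j.+1.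
Proof.
move=> ius usk; rewrite -(listsum_wedge_eq0 M0 siter2N cardF char2 ius) -listsumZ mulr_sumr.
under eq_bigr => a _.
  rewrite (_ : all _ _ = all (fun u => Lmap s N k (coefn a) u == 0) us); last first.
    by apply: eq_all => u; rewrite inE.
  rewrite -listsum_chi; over.
rewrite -listsum_sum; apply: eq_listsum => ws sws.
exact: chi_sum_dom.
Qed.

Lemma rad_subspace a : subspace s (rad a).
Proof.
split=> [|c x Kc]; last by rewrite !inE LmapZ // => /eqP->; rewrite mulr0.
split=> [|x y]; rewrite !inE ?raddf0 // => /eqP hx /eqP hy.
by rewrite raddfB /= hx hy subrr.
Qed.

Lemma sum_qfall_rad t : (t < k)%N ->
  \sum_(a in dom) qfall q%:R t #|rad a|%:R = #|dom|%:R * qmoment q%:R t X^-1.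
Proof.
move=> tk; apply: (mulfI (expf_neq0 t X0)).
transitivity (indsum s t [::] (fun us =>
    X ^+ t * \sum_(a in dom) (all [in rad a] us)%:R)).
  rewrite indsumZ indsum_sum; congr (_ * _); apply: eq_bigr => a _.
  by rewrite (indsum_subspace _ (rad_subspace a)) //= mul1r.
transitivity (indsum s t [::] (fun us : seq F => #|dom|%:R * \prod_(j < t) (q%:R : rat) ^+ j.+1)).
  by apply: eq_indsum => // us ius; rewrite add0n => sus; rewrite -sus card_ker_indep ?sus.
rewrite indsum_const mulrCA -mulrA; congr (_ * _).
have -> : X ^+ t = \prod_(j < t) X by rewrite prodr_const card_ord.
rewrite /qmoment -!big_split /=; apply: eq_bigr => j _.
by field.
Qed.

(* Changes only the coefficient of the linear term of [Q_a]. *)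
Definition linear_coef (c : F) : {ffun 'I_k.+1 -> F} := [ffun j => if j == ord_max then c else 0].

Lemma coefn_linear_coef a c j : (j < k)%N -> coefn (a + linear_coef c) j = coefn a j.
Proof.
move=> jk; rewrite /coefn !ffunE ifF ?addr0 //; apply/eqP => /(congr1 val).
by rewrite /= inordK; lia.
Qed.

Lemma eq_Lmap (a b : nat -> F) : (forall j, (j < k)%N -> a j = b j) -> Lmap s N k a =1 Lmap s N k b.
Proof.
move=> ab x; rewrite /Lmap ab //; congr (_ + _); apply: eq_big_nat => j jk.
by rewrite ab //; lia.
Qed.

Lemma rad_linear_coef a c : rad (a + linear_coef c) = rad a.
Proof.
apply/setP=> x; rewrite !inE (@eq_Lmap _ (coefn a)) // => j jk.
exact: coefn_linear_coef.
Qed.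

Lemma dom_linear_coef a c : (a + linear_coef c \in dom) = (a \in dom).
Proof.
rewrite !inE !ffunE ifF ?addr0 //; apply/eqP => /(congr1 val) /=.
by move: k_gt0; lia.
Qed.

(** * Exponential sums of the quadratic forms *)

Variable psi : {ffun 'I_k.+1 -> F} -> F -> rat.
Hypothesis psi_sq : forall a x, psi a x * psi a x = 1.
Hypothesis psiD : forall a x y, a \in dom ->
  psi a (x + y) = psi a x * psi a y * chi (y * Lmap s N k (coefn a) x).
Hypothesis psi_linear_coef : forall a c x, a \in dom -> psi (a + linear_coef c) x = psi a x * chi (c * x).

Definition Ssum a := \sum_x psi a x.

(** With [y = x + z] in the double sum, the sum over [x] forces [z] into the radical, on which
    [psi a] is a character. *)
Lemma Ssum_sq a : a \in dom -> Ssum a ^+ 2 = if Ssum a == 0 then 0 else X * #|rad a|%:R.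
Proof.
move=> ad.
have e : Ssum a ^+ 2 = X * \sum_(z in rad a) psi a z.
  transitivity (\sum_z psi a z * \sum_x chi (x * Lmap s N k (coefn a) z)).
    rewrite expr2 /Ssum mulr_suml.
    under eq_bigr => x _ do rewrite [X in _ * X](reindex_inj (addIr x)) /= mulr_sumr.
    rewrite exchange_big /=; apply: eq_bigr => z _; rewrite mulr_sumr.
    apply: eq_bigr => x _; rewrite psiD //.
    by rewrite -[RHS]mul1r -(psi_sq a x); ring.
  under eq_bigr do rewrite chi_sum_mul.
  rewrite mulr_sumr [RHS]big_mkcond /=; apply: eq_bigr => z _.
  by rewrite inE; case: ifP => _; rewrite ?mulr0 // mulrC.
case: ifP => [/eqP->|S0]; first by rewrite expr0n.
have hR : addset (rad a) by case: (rad_subspace a).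
rewrite e char_sum //; last first.
  by move=> x y; rewrite inE => /eqP Lx _; rewrite psiD // Lx mulr0 chi0 mulr1.
case: ifP => // h; move: e; rewrite char_sum ?h ?mulr0 //; last first.
  by move=> x y; rewrite inE => /eqP Lx _; rewrite psiD // Lx mulr0 chi0 mulr1.
by move/eqP; rewrite expf_eq0 S0.
Qed.

Lemma sum_Ssum_linear_coef a : a \in dom -> \sum_c Ssum (a + linear_coef c) ^+ 2 = X ^+ 2.
Proof.
move=> ad; transitivity (\sum_x \sum_y psi a x * psi a y * \sum_c chi (c * (x + y))).
  under eq_bigr => c _ do rewrite expr2 /Ssum mulr_suml.
  rewrite exchange_big /=; apply: eq_bigr => x _.
  under eq_bigr => c _ do rewrite mulr_sumr.
  rewrite exchange_big /=; apply: eq_bigr => y _; rewrite mulr_sumr.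
  by apply: eq_bigr => c _; rewrite !psi_linear_coef // mulrDr chiD; ring.
transitivity (\sum_(x : F) X); last by rewrite sumr_const expr2 mulr_natr.
apply: eq_bigr => x _; rewrite (bigD1 x) //= char2.
rewrite psi_sq mul1r chi_sum_mul eqxx big1 ?addr0 // => y yx.
rewrite chi_sum_mul ifF ?mulr0 //; apply: contraNF yx => /eqP xy.
by apply/eqP/(addrI x); rewrite xy char2.
Qed.

Lemma rad_neq0 a : (#|rad a|%:R : rat) != 0.
Proof.
rewrite pnatr_eq0 -lt0n; apply/card_gt0P; exists 0.
by case: (rad_subspace a) => -[].
Qed.

(* Translating [a] by [linear_coef c] does not change [rad a], and the squares of [Ssum] average
   to [#|F|] over [c]; a nonzero square equals [#|F| * #|rad a|]. *)
Lemma card_Ssum_neq0 :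
  #|[set a in dom | Ssum a != 0]|%:R = \sum_(a in dom) (#|rad a|%:R : rat)^-1.
Proof.
have -> : #|[set a in dom | Ssum a != 0]|%:R =
    \sum_(a in dom) Ssum a ^+ 2 / (X * #|rad a|%:R).
  rewrite -sum1_card natr_sum big_mkcond [RHS]big_mkcond /=; apply: eq_bigr => a _.
  rewrite inE; case: ifPn => [/andP[ad Sa]|].
    by rewrite ad Ssum_sq // (negPf Sa) divff // mulf_neq0 ?rad_neq0.
  by case: (boolP (a \in dom)) => //= ad; rewrite negbK => /eqP->; rewrite expr0n mul0r.
apply: (mulfI X0).
transitivity (\sum_(c : F) \sum_(a in dom) Ssum (a + linear_coef c) ^+ 2 / (X * #|rad a|%:R)).
  rewrite mulr_natl -sumr_const; apply: eq_bigr => c _.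
  rewrite [LHS](reindex_inj (addIr (linear_coef c))) /=.
  by apply: eq_big => [a|a _]; rewrite ?dom_linear_coef ?rad_linear_coef.
rewrite exchange_big mulr_sumr /=; apply: eq_bigr => a ad.
rewrite -mulr_suml sum_Ssum_linear_coef //; have := rad_neq0 a => r0.
by field; rewrite X0 r0.
Qed.

(** These vectors are treated apart: their radical is all of [F], of dimension [2 * N], outside the
    range [i < k] of [qfall2_inverse]. *)
Definition trivial_form (a : {ffun 'I_k.+1 -> F}) := [forall j : 'I_k.+1, (j != ord_max) ==> (a j == 0)].

Lemma rad_trivial a : trivial_form a -> rad a = [set: F].
Proof.
move=> /forallP a0; apply/setP=> x; rewrite !inE; apply/eqP.
rewrite (@eq_Lmap _ (fun=> 0)) => [|j jk].
  by rewrite /Lmap mul0r add0r big1 // => j _; rewrite !mul0r rmorph0 addr0.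
apply/eqP/(implyP (a0 _))/eqP => /(congr1 val) /=.
by rewrite inordK; lia.
Qed.

Lemma rad_nontrivial a : a \in dom -> ~~ trivial_form a ->
  exists2 i, (i < k)%N & #|rad a| = (q ^ (2 * i))%N.
Proof.
move=> ad /forallPn[j]; rewrite negb_imply => /andP[jk aj].
have [i e] := card_ker_Lmap_even k_gt0 k_leN siter2N cardF char2 (coefn0 ad).
exists i => //; have jk' : (j < k)%N.
  have := ltn_ord j; rewrite ltnS leq_eqVlt => /predU1P[ej|//].
  by case/eqP: jk; apply: val_inj.
have /(card_ker_Lmap s k_gt0 k_leN) : exists2 j, (j < k)%N & coefn a j != 0.
  by exists j => //; rewrite /coefn inord_val.
by rewrite e leq_exp2l //; lia.
Qed.

Lemma card_trivial_form : #|[set a in dom | trivial_form a]| = #|F|.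
Proof.
rewrite -cardsT -(card_imset _ (_ : injective linear_coef)); last first.
  by move=> c d /ffunP/(_ ord_max); rewrite !ffunE eqxx.
apply: eq_card => a; rewrite !inE; apply/andP/imsetP => [[_ /forallP h]|[c _ ->]].
  exists (a ord_max); rewrite ?inE //; apply/ffunP => j; rewrite !ffunE.
  by case: eqVneq => [->|jm] //; apply/eqP/(implyP (h j)).
have hn : (ord0 == ord_max :> 'I_k.+1) = false.
  by apply/eqP => /(congr1 val) /=; move: k_gt0; lia.
rewrite ffunE hn rmorph0 eqxx; split=> //; apply/forallP => j.
by apply/implyP => /negPf e; rewrite ffunE e.
Qed.

Lemma card_Ssum_neq0_formula :
  #|[set a in dom | Ssum a != 0]|%:R =
  1 + \sum_(v < k) (-1) ^+ v / q%:R ^+ (v * v.+1) *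
        (#|dom|%:R * qmoment2 q%:R v X^-1 - X * qfall2 q%:R v X).
Proof.
have dom2 v : (v < k)%N ->
    \sum_(a in dom) qfall2 q%:R v #|rad a|%:R = #|dom|%:R * qmoment2 q%:R v X^-1.
  move=> vk; have [c [cx cy]] := qfall2_expansion q0 v.
  under eq_bigr do rewrite cx; rewrite cy ?invr_eq0 // exchange_big mulr_sumr /=.
  apply: eq_bigr => t _; rewrite -mulr_sumr sum_qfall_rad; first by rewrite mulrCA.
  by apply: leq_trans vk; rewrite ltn_ord.
rewrite card_Ssum_neq0.
pose w v : rat := (-1) ^+ v / q%:R ^+ (v * v.+1).
(* The interpolation formula is used for every [a]; its error at [#|rad a| = #|F|] is added back for
   the trivial forms. *)
transitivity (\sum_(a in dom) (\sum_(v < k) w v * qfall2 q%:R v #|rad a|%:R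
    + if trivial_form a then X^-1 - \sum_(v < k) w v * qfall2 q%:R v X else 0)).
  apply: eq_bigr => a ad; case: ifPn => [/rad_trivial ->|ta].
    by rewrite cardsT addrC subrK.
  have [i ik ->] := rad_nontrivial ad ta.
  by rewrite natrX addr0 (qfall2_inverse q0 ik).
rewrite big_split /= exchange_big /= -big_mkcondr /=.
rewrite (eq_bigl [in [set a in dom | trivial_form a]]) => [|a]; last by rewrite !inE.
rewrite sumr_const card_trivial_form -[(_ - _) *+ _]mulr_natl mulrBr divff // addrCA; congr (_ + _).
rewrite mulr_sumr -sumrB; apply: eq_bigr => v _.
by rewrite -mulr_sumr dom2 // /w; ring.
Qed.

(** A constant [psi a] has full radical, so only the linear coefficient can survive, and
    nondegeneracy of [tr] kills it. *)
Lemma psi_eq1 a : a \in dom -> (forall x, psi 0 x = 1) -> (forall x, psi a x = 1) -> a = 0.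
Proof.
move=> ad psi0 psi1.
have hR : rad a = [set: F].
  apply/setP=> x; rewrite !inE; apply/eqP/tr_nondeg => y; apply/eqP.
  by rewrite mulrC -chi_eq1; have := psiD x y ad; rewrite !psi1 !mul1r => <-.
have ta : trivial_form a.
  apply: contraT => /(rad_nontrivial ad)[i ik]; rewrite hR cardsT cardF => /eqP.
  by rewrite eqn_exp2l //; lia.
have ea : a = 0 + linear_coef (a ord_max).
  apply/ffunP => j; rewrite !ffunE add0r; case: eqVneq => [->//|jm].
  by have /forallP/(_ j)/implyP/(_ jm)/eqP := ta.
suff -> : a = 0 + linear_coef 0 by apply/ffunP => j; rewrite !ffunE add0r; case: ifP.
rewrite ea; congr (_ + linear_coef _); apply: tr_nondeg => x; apply/eqP.
by rewrite -chi_eq1; have := psi_linear_coef (a ord_max) x dom_addset.1; rewrite -ea psi0 psi1 mul1r mulrC => <-.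
Qed.

End Moments.

(** * The code *)

Section FrobeniusPowers.

Variable F : finFieldType.

Lemma frob_rmorphism_exists r : 2 \in [pchar F] ->
  exists t : {rmorphism F -> F}, forall x, t x = x ^+ (2 ^ r).
Proof.
move=> ch; elim: r => [|r [t tE]]; first by exists idfun.
exists (pFrobenius_aut ch \o t) => x /=.
by rewrite pFrobenius_autE tE -exprM expnSr.
Qed.

Lemma exp2_iter r c (x : F) : x ^+ (2 ^ r) = x -> x ^+ (2 ^ (r * c)) = x.
Proof.
move=> xr; elim: c => [|c IH]; first by rewrite muln0.
by rewrite mulnS expnD exprM xr.
Qed.

Lemma exp2_gcd m d (x : F) : (0 < m)%N -> x ^+ (2 ^ m) = x -> x ^+ (2 ^ d) = x ->
  x ^+ (2 ^ gcdn m d) = x.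
Proof.
move=> m0 xm xd; have [a _ /dvdnP[c e]] := Bezoutl d m0.
have: x ^+ (2 ^ (gcdn m d + a * d)) = x by rewrite e mulnC exp2_iter.
by rewrite addnC expnD exprM mulnC exp2_iter.
Qed.

Lemma prim_root_neq0 l (z : F) : l.-primitive_root z -> z != 0.
Proof.
move=> pz; apply/eqP => z0; have := prim_expr_order pz; move/eqP.
by rewrite z0 expr0n gtn_eqF ?(prim_order_gt0 pz) // eq_sym oner_eq0.
Qed.

(** The fixed points are zero and the powers of a suitable power [z] of [pi], of order
    [2 ^ r - 1]. *)
Lemma card_exp2_fix m r (pi : F) : (0 < r)%N -> (r %| m)%N ->
  (2 ^ m).-1.-primitive_root pi -> #|[set x : F | x ^+ (2 ^ r) == x]| = (2 ^ r)%N.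
Proof.
move=> r0 /dvdnP[c ->]; rewrite mulnC expnM => prim.
have := dvdn_prim_root prim (dvdn_pred_predX (2 ^ r) c).
set z := pi ^+ _; set Q := (2 ^ r)%N => pz.
have Q1 : (1 < Q)%N by rewrite -[1%N](expn0 2) ltn_exp2l.
have QE : Q = Q.-1.+1 by rewrite prednK // ltnW.
have z0 : z != 0 := prim_root_neq0 pz.
have -> : [set x : F | x ^+ Q == x] = 0 |: [set z ^+ (i : 'I_Q.-1) | i in 'I_Q.-1].
  apply/setP=> x; rewrite !inE; have [->|x0] /= := eqVneq x 0.
    by rewrite expr0n gtn_eqF ?eqxx //; lia.
  apply/eqP/imsetP => [xQ|[i _ ->]].
    have /(prim_rootP pz)[i ->] : x ^+ Q.-1 = 1.
      by apply: (mulfI x0); rewrite -exprS -QE mulr1.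
    by exists i.
  have zQ : z ^+ Q = z by rewrite {1}QE exprS prim_expr_order ?mulr1.
  by rewrite -exprM mulnC exprM zQ.
rewrite cardsU1 card_imset ?card_ord; last first.
  move=> i j /eqP; rewrite (eq_prim_root_expr pz) !modn_small // => /eqP.
  exact: val_inj.
rewrite [X in (X + _)%N](_ : _ = 1%N) ?add1n -?QE //.
suff -> : (0 \notin [set z ^+ (i : 'I_Q.-1) | i in 'I_Q.-1]) by [].
by apply/imsetP => -[i _ /eqP]; rewrite eq_sym expf_eq0 (negPf z0) andbF.
Qed.

Lemma siter_exp2 (s : {rmorphism F -> F}) d : (forall x, s x = x ^+ (2 ^ d)) ->
  forall l x, siter s l x = x ^+ (2 ^ (d * l)).
Proof.
move=> sE; elim=> [|l IH] x; first by rewrite muln0.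
by rewrite siterS sE IH -exprM -expnD addnC mulnS.
Qed.

Lemma prim_root_inv_sum (R : nmodType) n (pi : F) (f : F -> R) :
  #|F| = n.+1 -> n.-primitive_root pi ->
  \sum_(x : F) f x = f 0 + \sum_(i < n) f (pi^-1 ^+ i).
Proof.
move=> cF prim; rewrite (bigD1 0) //=; congr (_ + _).
have pi0 : pi != 0 := prim_root_neq0 prim.
have inj : injective (fun i : 'I_n => pi^-1 ^+ i).
  move=> i j; rewrite !exprVn => /invr_inj/eqP.
  by rewrite (eq_prim_root_expr prim) !modn_small // => /eqP; apply: val_inj.
rewrite -(big_imset f (A := 'I_n)) /=; last by move=> i j _ _; apply: inj.
apply: eq_bigl => x; apply/idP/idP; last first.
  by case/imsetP=> i _ ->; rewrite expf_neq0 // invr_eq0.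
have /subset_cardP/(_ _)h : #|[set pi^-1 ^+ (i : 'I_n) | i in 'I_n]| = #|[set~ (0 : F)]|.
  by rewrite card_imset // card_ord cardsC1 cF.
rewrite h ?inE //; apply/subsetP=> _ /imsetP[i _ ->].
by rewrite !inE expf_neq0 // invr_eq0.
Qed.

Lemma trK_tower (phi : {rmorphism F -> F}) e r y :
  trK phi e (\sum_(i < r) siter phi (e * i) y) = trK phi (e * r) y.
Proof.
elim: r => [|r IH]; first by rewrite big_ord0 raddf0 muln0 /trK big_ord0.
by rewrite big_ord_recr raddfD /= IH mulnSr trK_addn.
Qed.

End FrobeniusPowers.

Section Code.

Variables (m n d e k : nat) (F : finFieldType) (pi : F) (phi s : {rmorphism F -> F}).
Hypothesis n_gt0 : (0 < n)%N.
Hypothesis k_gt0 : (0 < k)%N.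
Hypothesis mE : m = (2 * n)%N.
Hypothesis eE : e = gcdn n d.
Hypothesis eE' : e = gcdn m d.
Hypothesis k_le : (k <= n %/ e)%N.
Hypothesis cardF : #|F| = (2 ^ m)%N.
Hypothesis pi_prim : (2 ^ m).-1.-primitive_root pi.
Hypothesis phiE : forall x, phi x = x ^+ 2.
Hypothesis sE : forall x, s x = x ^+ (2 ^ d).

Local Notation N := (n %/ e)%N.

Let m_gt0 : (0 < m)%N. Proof. by rewrite mE; lia. Qed.
Let e_gt0 : (0 < e)%N. Proof. by rewrite eE gcdn_gt0 n_gt0. Qed.
Let nE : n = (e * N)%N. Proof. by rewrite mulnC divnK // eE dvdn_gcdl. Qed.
Let dE : d = (e * (d %/ e))%N. Proof. by rewrite mulnC divnK // eE dvdn_gcdr. Qed.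

Let char2 (x : F) : x + x = 0.
Proof.
have ch : 2 \in [pchar F] by apply: card_finPcharP cardF _.
by rewrite -mulr2n -mulr_natl (pcharf0 ch) mul0r.
Qed.

(** Otherwise [2 * e] would divide both [m = 2 * n] and [d], hence [gcdn m d = e]. *)
Lemma d_div_e_odd : odd (d %/ e).
Proof.
apply: contraT; rewrite -dvdn2 => /dvdnP[c hc].
have : (2 * e %| gcdn m d)%N.
  rewrite dvdn_gcd mE; apply/andP; split.
    by rewrite dvdn_pmul2l // eE dvdn_gcdl.
  by rewrite dE hc [X in (X %| _)%N]mulnC dvdn_pmul2l ?dvdn_mull.
by rewrite -eE' => /(dvdn_leq e_gt0); move: e_gt0; lia.
Qed.

Lemma exp2_m (x : F) : x ^+ (2 ^ m) = x.
Proof. by rewrite -cardF expf_card. Qed.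

Lemma siter_phi l x : siter phi l x = x ^+ (2 ^ l).
Proof. by rewrite (@siter_exp2 _ phi 1) ?mul1n. Qed.

Lemma siter_s l x : siter s l x = x ^+ (2 ^ (d * l)).
Proof. exact: siter_exp2. Qed.

(** [d * N = n * (d / e)] is congruent to [n] modulo [m = 2 * n], because [d / e] is odd. *)
Lemma siter_sN x : siter s N x = x ^+ (2 ^ n).
Proof.
rewrite siter_s; have -> : (d * N = m * (d %/ e)./2 + n)%N.
  rewrite {1}dE mulnAC -nE -{1}(odd_double_half (d %/ e)) d_div_e_odd mE -muln2; lia.
by rewrite expnD exprM exp2_iter // exp2_m.
Qed.

Let siter2N x : siter s (2 * N) x = x.
Proof.
by rewrite mul2n -addnn siterD !siter_sN -exprM -expnD addnn -mul2n -mE exp2_m.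
Qed.

Lemma fixfield_s : fixfield s = [set x | x ^+ (2 ^ e) == x].
Proof.
apply/setP=> x; rewrite !inE sE; apply/eqP/eqP => h.
  by rewrite eE' exp2_gcd // exp2_m.
by rewrite dE exp2_iter.
Qed.

Let card_s : #|fixfield s| = (2 ^ e)%N.
Proof.
by rewrite fixfield_s (card_exp2_fix e_gt0 _ pi_prim) // eE' dvdn_gcdl.
Qed.

Let cardF_s : #|F| = (#|fixfield s| ^ (2 * N))%N.
Proof. by rewrite cardF card_s -expnM mulnCA -nE -mE. Qed.

Let siter2n x : siter phi (2 * n) x = x.
Proof. by rewrite -mE siter_phi exp2_m. Qed.

Let cardF_phi : #|F| = (#|fixfield phi| ^ (2 * n))%N.
Proof.
rewrite -mE cardF (_ : fixfield phi = [set x | x ^+ (2 ^ 1) == x]).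
  by rewrite (card_exp2_fix _ _ pi_prim) ?dvd1n.
by apply/setP=> x; rewrite !inE phiE.
Qed.

Local Notation tr := (trK phi m).

Lemma tr_fixN y : siter s N y = y -> tr y = 0.
Proof.
rewrite siter_sN -siter_phi mE => yn.
exact: trK_double.
Qed.

Lemma tr_phi y : tr (phi y) = tr y.
Proof. by rewrite trK_s // mE. Qed.

Lemma tr_s y : tr (s y) = tr y.
Proof.
rewrite sE -siter_phi; elim: d => // l IH.
by rewrite siterS tr_phi.
Qed.

Lemma tr_nondeg v : (forall x, tr (v * x) = 0) -> v = 0.
Proof. by rewrite mE; apply: trK_nondeg; rewrite ?muln_gt0. Qed.

(** Squaring permutes the summands cyclically, so the trace equals its own square. *)
Lemma trK_01 M y : siter phi M y = y -> trK phi M y = 0 \/ trK phi M y = 1.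
Proof.
move=> yM; have e2 : trK phi M y ^+ 2 = trK phi M y.
  have t1 x : trK phi 1 x = x by rewrite /trK big_ord1.
  have := trK_addn phi 1 M y; rewrite addnC trK_addn yM !t1 addrC => /addrI e1.
  by rewrite [RHS]e1 -phiE /trK rmorph_sum; apply: eq_bigr => i _; rewrite -siterSr.
have /eqP : trK phi M y * (trK phi M y - 1) = 0 by rewrite mulrBr mulr1 -expr2 e2 subrr.
by rewrite mulf_eq0 subr_eq0 => /orP[/eqP|/eqP]; [left | right].
Qed.

(** The absolute trace of [Q_a x] after transitivity of traces. The first term is a trace from the
    subfield of [2 ^ n] elements, hence of half length. *)
Definition tval (a : {ffun 'I_k.+1 -> F}) (x : F) :=
  trK phi n (a ord0 * (siter s N x * x))
  + \sum_(1 <= j < k) tr (a (inord j) * (siter s (N - j) x * x))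
  + tr (a ord_max * x).

Lemma tr2_trK r y : tr2 1 r y = trK phi r y.
Proof. by apply: eq_bigr => i _; rewrite siter_phi mul1n. Qed.

Lemma tr2_tower r y : tr2 1 e (tr2 e r y) = trK phi (e * r) y.
Proof.
rewrite tr2_trK -trK_tower /tr2; congr (trK _ _ _).
by apply: eq_bigr => i _; rewrite siter_phi.
Qed.

Lemma tr2_Qa a x : tr2 1 e (Qa m n d e a x) = tval a x.
Proof.
have mE' : m = (e * (m %/ e))%N by rewrite mulnC divnK // eE' dvdn_gcdl.
rewrite tr2_trK /Qa !raddfD /= -!tr2_trK !tr2_tower -mE' -nE tr2_trK.
rewrite [X in _ + X + _]raddf_sum /=.
rewrite /tval; congr (_ + _ + _).
  rewrite siter_s exprD expr1; congr (trK _ _ (_ * (_ ^+ (2 ^ _) * _))).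
  by rewrite {1}nE -mulnA mulKn // mulnC.
apply: eq_bigr => j _; rewrite -tr2_trK tr2_tower -mE' siter_s exprD expr1.
by rewrite [((_ - _) * _)%N]mulnC.
Qed.

Local Notation dm := (@dom F s N k).

Lemma coeff_domE : coeff_dom F n k = dm.
Proof. by apply/setP=> a; rewrite !inE siter_sN. Qed.

Lemma tval_addl a b x : tval (a + b) x = tval a x + tval b x.
Proof.
rewrite /tval !ffunE !mulrDl !raddfD /=.
rewrite (eq_bigr (fun j => tr (a (inord j) * (siter s (N - j) x * x)) +
                           tr (b (inord j) * (siter s (N - j) x * x)))).
  by rewrite big_split /=; ring.
by move=> j _; rewrite ffunE mulrDl raddfD.
Qed.

Lemma tval_subl a b x : tval (a - b) x = tval a x + tval b x.
Proof.
have -> : - b = b by apply/ffunP => j; rewrite ffunE; apply/eqP; rewrite eq_sym -addr_eq0 char2.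
exact: tval_addl.
Qed.

Lemma tval_addr a x y : a \in dm ->
  tval a (x + y) = tval a x + tval a y + tr (y * Lmap s N k (coefn a) x).
Proof.
move=> ad; have a0 : a ord0 ^+ (2 ^ n) = a ord0 by move: ad; rewrite inE siter_sN => /eqP.
rewrite (invariant_mul_Lmap k_le siter2N tr_s) raddfD raddf_sum /tval /=.
rewrite (mulrDr (a ord_max)) (raddfD _ (a ord_max * x)) /=.
(* The two cross terms are conjugate under [s ^ N], so their half-length traces add up to one full
   trace. *)
have -> : trK phi n (a ord0 * (siter s N (x + y) * (x + y))) =
    trK phi n (a ord0 * (siter s N x * x)) + trK phi n (a ord0 * (siter s N y * y))
    + tr (coefn a 0 * (y * siter s N x)).
  rewrite mE mul2n -addnn trK_addn /coefn inord0 siter_phi -raddfD -!raddfD.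
  congr (trK _ _ _); rewrite !siter_sN !exprMn a0 -exprM -expnD addnn -mul2n -mE exp2_m.
  have -> : (x + y) ^+ (2 ^ n) = x ^+ (2 ^ n) + y ^+ (2 ^ n).
    by rewrite -!siter_phi rmorphD.
  ring.
have -> : \sum_(1 <= j < k) tr (a (inord j) * (siter s (N - j) (x + y) * (x + y))) =
    \sum_(1 <= j < k) tr (a (inord j) * (siter s (N - j) x * x)) +
    \sum_(1 <= j < k) tr (a (inord j) * (siter s (N - j) y * y)) +
    \sum_(1 <= j < k) tr (coefn a j * (y * siter s (N - j) x + x * siter s (N - j) y)).
  rewrite -!big_split /=; apply: eq_bigr => j _.
  by rewrite -!raddfD rmorphD /=; congr (trK _ _ _); rewrite /coefn; ring.
ring.
Qed.

Lemma add_01 (u v : F) : u = 0 \/ u = 1 -> v = 0 \/ v = 1 -> u + v = 0 \/ u + v = 1.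
Proof. by case=> -> [] ->; rewrite ?addr0 ?add0r ?char2; auto. Qed.

Lemma tr_01 y : tr y = 0 \/ tr y = 1.
Proof. by apply: trK_01; rewrite siter_phi exp2_m. Qed.

Lemma tval_01 a x : a \in dm -> tval a x = 0 \/ tval a x = 1.
Proof.
move=> ad; have a0 : a ord0 ^+ (2 ^ n) = a ord0 by move: ad; rewrite inE siter_sN => /eqP.
apply: add_01; [apply: add_01 | exact: tr_01].
  apply: trK_01; rewrite siter_phi siter_sN !exprMn a0 -exprM -expnD addnn -mul2n -mE.
  by rewrite exp2_m [x * _]mulrC.
by elim/big_ind: _ => [|u v hu hv|j _]; [left | apply: add_01 | apply: tr_01].
Qed.

Definition psi a x := sgn2 (tval a x).

Lemma psi_sq a x : psi a x * psi a x = 1.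
Proof. by rewrite /psi /sgn2; case: ifP; rewrite ?mulr1 ?mulrNN ?mulr1. Qed.

Lemma psiD a x y : a \in dm ->
  psi a (x + y) = psi a x * psi a y * chi tr (y * Lmap s N k (coefn a) x).
Proof.
move=> ad; have [tx ty] := (tval_01 x ad, tval_01 y ad).
rewrite /psi /chi tval_addr // sgn2D; [|exact: char2|exact: add_01|exact: tr_01].
by rewrite sgn2D.
Qed.

Lemma psi_linear_coef a c x : a \in dm -> psi (a + linear_coef k c) x = psi a x * chi tr (c * x).
Proof.
move=> ad; have tdk : tval (linear_coef k c) x = tr (c * x).
  rewrite /tval /linear_coef !ffunE eqxx ifF; last first.
    by apply/eqP => /(congr1 val) /=; move: k_gt0; lia.
  rewrite mul0r raddf0 add0r big_nat big1 ?add0r // => j jk.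
  rewrite ffunE ifF ?mul0r ?raddf0 //; apply/eqP => /(congr1 val) /=.
  by rewrite inordK; lia.
rewrite /psi /chi tval_addl tdk sgn2D //; [exact: tval_01 | exact: tr_01].
Qed.

Lemma tval0l x : tval 0 x = 0.
Proof. by rewrite -(subrr (0 : {ffun 'I_k.+1 -> F})) tval_subl char2. Qed.

Lemma tval0r a : tval a 0 = 0.
Proof.
rewrite /tval !rmorph0 !mulr0 !raddf0 big1 ?addr0 // => j _.
by rewrite rmorph0 !mulr0 raddf0.
Qed.

(** The inverse powers of [pi] run through the nonzero elements, and [x = 0] contributes one to
    [Ssum]. Hence [DC = -1] means [Ssum = 0]. *)
Lemma DC_codeword a : (DC (codeword m n d e pi a))%:~R = Ssum psi a - 1 :> rat.
Proof.
have cF : #|F| = (2 ^ m).-1.+1 by rewrite cardF prednK // expn_gt0.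
rewrite /Ssum (prim_root_inv_sum _ cF pi_prim) {1}/psi tval0r sgn2_0 addrAC subrr add0r.
rewrite /DC rmorph_sum; apply: eq_bigr => i _.
by rewrite ffunE tr2_Qa /psi /sgn2; case: eqP => _; rewrite ?expr0 ?expr1.
Qed.

(** Equal codewords give equal values of [tval] at every point, so [psi (a - b)] is constantly
    one. *)
Lemma codeword_inj : {in dm &, injective (codeword m n d e pi)}.
Proof.
move=> a b ad bd e_ab; apply/eqP; rewrite -subr_eq0; apply/eqP.
have abd : a - b \in dm by apply: (dom_addset s N k).2.
apply: (psi_eq1 k_gt0 k_le siter2N cardF_s char2 tr_nondeg psiD psi_linear_coef abd) => x.
  by rewrite /psi tval0l sgn2_0.
rewrite /psi tval_subl; suff -> : tval a x = tval b x by rewrite char2 sgn2_0.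
have [->|x0] := eqVneq x 0; first by rewrite !tval0r.
have [i xi] : exists i : 'I_(2 ^ m).-1, x = pi^-1 ^+ i.
  have /(prim_rootP pi_prim)[i e_i] : x^-1 ^+ (2 ^ m).-1 = 1.
    have x0' : x^-1 != 0 by rewrite invr_eq0.
    by apply: (mulfI x0'); rewrite mulr1 -exprS prednK ?expn_gt0 // exp2_m.
  by exists i; rewrite exprVn -e_i invrK.
have /ffunP/(_ i) := e_ab; rewrite !ffunE !tr2_Qa -xi.
have [] := tval_01 x ad => ->; have [] := tval_01 x bd => ->; rewrite ?eqxx ?oner_eq0 //.
Qed.

Lemma card_DC :
  #|[set c in code m n d e k pi | DC c == -1]| = #|[set a in dm | Ssum psi a == 0]|.
Proof.
have -> : [set c in code m n d e k pi | DC c == -1] =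
    codeword m n d e pi @: [set a in dm | Ssum psi a == 0].
  have DC0 a : (DC (codeword m n d e pi a) == -1) = (Ssum psi a == 0).
    by rewrite -(eqr_int rat) DC_codeword rmorphN1 subr_eq addNr.
  apply/setP=> c; rewrite inE /code coeff_domE; apply/andP/imsetP.
    by case=> /imsetP[a ad ->]; rewrite DC0 => h; exists a; rewrite // inE ad.
  by case=> a; rewrite inE => /andP[ad h] ->; rewrite DC0 imset_f.
by rewrite card_in_imset // => a b; rewrite !inE => /andP[ad _] /andP[bd _]; apply: codeword_inj; rewrite inE.
Qed.

Lemma card_DC_formula :
  (#|[set c in code m n d e k pi | DC c == -1]|%:R : rat) =
    (2%:R ^+ (n * (2 * k + 1)) - 1
     - \sum_(0 <= v < k)
         (-1) ^+ v * (2%:R ^+ (n * (2 * k - 1 - 2 * v) + e * v) - 1)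
         * (2%:R ^ ((m%:Z) - (e * v * (v + 1))%:Z))
         * \prod_(0 <= j < v) (2%:R ^+ m - 4%:R ^+ (e * j)) : rat).
Proof.
have := card_Ssum_neq0_formula k_gt0 k_le siter2N cardF_s char2 tr_s tr_fixN
  tr_nondeg tr_01 psi_sq psiD psi_linear_coef.
have cdom : #|dm| = (2 ^ (n * (2 * k + 1)))%N.
  rewrite card_dom (_ : [set y | _] = [set y | y ^+ (2 ^ n) == y]); last first.
    by apply/setP=> y; rewrite !inE siter_sN.
  rewrite (card_exp2_fix n_gt0 _ pi_prim) ?cardF; last by rewrite mE dvdn_mull.
  by rewrite -expnM -expnD mE; congr (_ ^ _)%N; lia.
have csplit : #|dm|%:R =
    #|[set a in dm | Ssum psi a == 0%R]|%:R + #|[set a in dm | Ssum psi a != 0%R]|%:R :> rat.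
  rewrite -natrD -(cardsID [set a | Ssum psi a == 0%R] dm); congr (_ + _)%:R.
    by apply: eq_card => a; rewrite !inE.
  by apply: eq_card => a; rewrite !inE andbC.
rewrite card_DC => e_neq; move/eqP: csplit; rewrite -subr_eq => /eqP <-.
rewrite e_neq cdom natrX opprD addrA big_mkord; congr (_ - _); apply: eq_bigr => v _.
have X0 : (#|F|%:R : rat) != 0 by rewrite cardF natrX expf_neq0.
have q0 : (#|fixfield s|%:R : rat) != 0 by rewrite card_s natrX expf_neq0.
have -> : \prod_(0 <= j < v) (2%:R ^+ m - 4%:R ^+ (e * j)) =
    qfall2 (#|fixfield s|%:R : rat) v #|F|%:R.
  rewrite big_mkord; apply: eq_bigr => j _; rewrite cardF card_s !natrX -[4%N]/(2 ^ 2)%N natrX.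
  by rewrite -!exprM; congr (_ - _ ^+ _); lia.
have -> : (2%:R : rat) ^ ((m%:Z) - (e * v * (v + 1))%:Z) =
    #|F|%:R / #|fixfield s|%:R ^+ (v * v.+1).
  by rewrite expfzDr // -exprnN cardF card_s !natrX -exprM addn1 mulnA.
have -> : (2%:R : rat) ^+ (n * (2 * k - 1 - 2 * v) + e * v) =
    2%:R ^+ (n * (2 * k - 1 - 2 * v)) * #|fixfield s|%:R ^+ v.
  by rewrite card_s natrX -exprM exprD.
(* [n * (2 * k + 1) = m + m * v + n * (2 * k - 1 - 2 * v)]; since [v < k], no subtraction is
   truncated. *)
have -> : (2%:R : rat) ^+ (n * (2 * k + 1)) =
    #|F|%:R * #|F|%:R ^+ v * 2%:R ^+ (n * (2 * k - 1 - 2 * v)).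
  rewrite cardF natrX -exprM -!exprD mE; congr (_ ^+ _).
  have -> : (2 * k + 1 = 2 * k - 1 - 2 * v + 2 * v + 2)%N by have := ltn_ord v; lia.
  by move: (_ - _ - _)%N => w; nia.
rewrite qmoment2V //.
by field; rewrite !expf_neq0.
Qed.

End Code.

Unset Implicit Arguments.

Theorem theorem1p3 (m n d e k : nat) (F : finFieldType) (pi : F) :
  (0 < m)%N -> (0 < n)%N -> (0 < d)%N -> (0 < e)%N -> (0 < k)%N ->
  m = (2 * n)%N -> e = gcdn n d -> e = gcdn m d ->
  (1 <= k <= n %/ e)%N ->
  #|F| = (2 ^ m)%N ->
  (2 ^ m).-1.-primitive_root pi ->
  (#|[set c in code m n d e k pi | DC c == -1]|%:R : rat) =
    (2%:R ^+ (n * (2 * k + 1)) - 1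
     - \sum_(0 <= v < k)
         (-1) ^+ v * (2%:R ^+ (n * (2 * k - 1 - 2 * v) + e * v) - 1)
         * (2%:R ^ ((m%:Z) - (e * v * (v + 1))%:Z))
         * \prod_(0 <= j < v) (2%:R ^+ m - 4%:R ^+ (e * j)) : rat).
Proof.
move=> m0 n0 d0 e0 k0 mE eE eE' /andP[_ kN] cF prim.
have ch : 2 \in [pchar F] by apply: card_finPcharP cF _.
have [phi phiE] := frob_rmorphism_exists 1 ch.
have [s sE] := frob_rmorphism_exists d ch.
exact: (card_DC_formula n0 k0 mE eE eE' kN cF prim phiE sE).
Qed.
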